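(* Let $A$ and $B$ be systems of qubits, let $A_1,A_2$ be qubits of $A$ and $B_1,B_2$ qubits of $B$. Let $U_{A_1,B_1}$ and $V_{A_2,B_2}$ be two-qubit unitaries acting on the indicated qubits, with KAK parameters $(u_k)_{k=0}^3$ and $(v_k)_{k=0}^3$, respectively. Then $U_{A_1,B_1}$ and $V_{A_2,B_2}$ have a decomposition that is independent of the black box channel, with optimal black box overhead $$\overline{\gamma}_{\mathrm{LOCC}}(U_{A_1,B_1},V_{A_2,B_2})=\overline{\gamma}_{\mathrm{LO}}(U_{A_1,B_1},V_{A_2,B_2})=1+2\sum_{\mathbf{k}\neq\mathbf{k}'}|w_{\mathbf{k}}|\,|w_{\mathbf{k}'}| ,$$ where the sum is over all ordered pairs of distinct $\mathbf{k},\mathbf{k}'\in\{0,1,2,3\}^2$ and $w_{\mathbf{k}}=u_{k_1}v_{k_2}$.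
   Context: All Hilbert spaces are finite-dimensional. $\mathrm{CPTP}(X)$ is the set of completely positive trace-preserving maps on system $X$. KAK parameters: every two-qubit unitary $U$ can be written as $U=(V_1\otimes V_2)\big(\sum_{k=0}^3 u_k\,\sigma_k\otimes\sigma_k\big)(V_3\otimes V_4)$ with single-qubit unitaries $V_1,\dots,V_4$, $\sigma_0$ the identity matrix, $\sigma_1,\sigma_2,\sigma_3$ the Pauli matrices $X,Y,Z$, and $u_k\in\mathbb{C}$ with $\sum_k|u_k|^2=1$. The $u_k$ are called the KAK parameters of $U$. Local operations: $\mathcal{N}(X)=\{\mathcal{A}^+-\mathcal{A}^-:\ \mathcal{A}^\pm \text{ completely positive},\ \mathcal{A}^++\mathcal{A}^-\in\mathrm{CPTP}(X)\}$ and $\mathrm{LO}(A,B)=\{\mathcal{F}_A\otimes\mathcal{F}_B:\ \mathcal{F}_A\in\mathcal{N}(A),\ \mathcal{F}_B\in\mathcal{N}(B)\}$. LOCC: an instrument is a finite family $(\mathcal{E}_i)$ of completely positive maps whose sum is trace preserving. A one-way local instrument from $A$ has the form $(\mathcal{E}_i\otimes\mathcal{T}_i)_i$ with $(\mathcal{E}_i)$ an instrument on $A$ and each $\mathcal{T}_i$ CPTP on $B$ (analogously from $B$). An LOCC instrument is obtained by finitely many rounds, in each of which a one-way local instrument (from $A$ or from $B$, possibly changing the local finite dimensions) is applied that may depend on all previous outcomes, followed by coarse-graining (summing) of outcomes. $\mathrm{LOCC}(A,B)$ is the set of maps $\sum_i s_i\mathcal{E}_i$ on $AB$ with $(\mathcal{E}_i)$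 an LOCC instrument and $s_i\in\{+1,-1\}$. Black box $\gamma$-factor: for channels $\mathcal{E}^1_{AB},\mathcal{E}^2_{AB}$ and $S\in\{\mathrm{LO},\mathrm{LOCC}\}$, $\overline{\gamma}_S(\mathcal{E}^1_{AB},\mathcal{E}^2_{AB})$ is the minimum of $\sum_{i=1}^m|a_i|$ over all finite-dimensional ancillary systems $E_A,E_B$, all $m\ge1$, $a_i\in\mathbb{R}$ and $\mathcal{F}_i,\mathcal{G}_i\in S(AE_A,BE_B)$ such that, simultaneously for all $X_{AB}\in\mathrm{CPTP}(AB)$ (the black box channel), $$\mathcal{E}^1_{AB}\circ X_{AB}\circ\mathcal{E}^2_{AB}=\mathrm{tr}_{E_AE_B}\sum_{i=1}^m a_i\,\mathcal{F}_i\circ X_{AB}\circ\mathcal{G}_i .$$ On the right, $X_{AB}$ acts as the identity on $E_AE_B$, and the ancillas $E_A,E_B$ are initialized in a fixed product state $|0\rangle_{E_A}|0\rangle_{E_B}$ before $\mathcal{G}_i$, so both sides are maps on $AB$. The $a_i,\mathcal{F}_i,\mathcal{G}_i$ may not depend on $X_{AB}$. For unitaries, $\overline{\gamma}_S(U,V)$ refers to the channels $\rho\mapsto U\rho U^\dagger$ and $\rho\mapsto V\rho V^\dagger$, where a unitary on a subset of the qubits acts as the identity on the others. *)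

(* Defs.v *)
(* The real numbers are any R : realType and the complex numbers are R[i]; the
   product basis of a tensor product is enumerated by mxtens_index. *)
From mathcomp Require Import all_boot all_order all_algebra.
From mathcomp Require Import classical_sets reals.
From mathcomp Require Import complex mxtens.

Set Implicit Arguments.
Unset Strict Implicit.
Unset Printing Implicit Defensive.

Import Order.TTheory GRing.Theory Num.Theory.
Local Open Scope ring_scope.
Local Open Scope sesquilinear_scope.
Local Open Scope complex_scope.

Notation normc := ComplexField.Normc.normc.

Section Maps.
Variable R : realType.
Local Notation C := R[i].

Definition super (m n : nat) := 'M[C]_m -> 'M[C]_n.

(* The order of R[i] makes [0 <= z] imply that z is real. *)
Definition psd n (rho : 'M[C]_n) :=
  forall v : 'cV[C]_n, 0 <= (v ^t* *m rho *m v) 0 0.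

Definition block m p (rho : 'M[C]_(m * p)) (i j : 'I_m) : 'M[C]_p :=
  \matrix_(k, l) rho (mxtens_index (i, k)) (mxtens_index (j, l)).

(* For linear f and g this is the tensor product of f and g, because
   rho = \sum_(i, j) delta_mx i j *t block rho i j. *)
Definition tens_map m n p q (f : super m n) (g : super p q) :
    super (m * p) (n * q) :=
  fun rho => \sum_i \sum_j f (delta_mx i j) *t g (block rho i j).

Definition ptrace2 m p (rho : 'M[C]_(m * p)) : 'M[C]_m :=
  \matrix_(i, j) \sum_k rho (mxtens_index (i, k)) (mxtens_index (j, k)).

Definition CP m n (f : super m n) :=
  linear f /\
  forall (k : nat) (rho : 'M[C]_(k * m)),
    psd rho -> psd (tens_map (@id 'M[C]_k) f rho).

Definition TP m n (f : super m n) := forall rho, \tr (f rho) = \tr rho.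

Definition CPTP m n (f : super m n) := CP f /\ TP f.

Definition instrument m n (I : finType) (E : I -> super m n) :=
  (forall i, CP (E i)) /\ TP (fun rho => \sum_i E i rho).

(* The set written N(X) for a system X of dimension n. *)
Definition calN n : set (super n n) :=
  [set f | exists Ap Am : super n n,
     [/\ CP Ap, CP Am, CPTP (fun rho => Ap rho + Am rho)
       & forall rho, f rho = Ap rho - Am rho]].

Definition LO (a b : nat) : set (super (a * b) (a * b)) :=
  [set F | exists (FA : super a a) (FB : super b b),
     [/\ calN FA, calN FB & forall rho, F rho = tens_map FA FB rho]].

Definition one_way_fromA a b a' b' (I : finType)
    (G : I -> super (a * b) (a' * b')) :=
  exists (E : I -> super a a') (T : I -> super b b'),
    [/\ instrument E, forall i, CPTP (T i)
      & forall i rho, G i rho = tens_map (E i) (T i) rho].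

Definition one_way_fromB a b a' b' (I : finType)
    (G : I -> super (a * b) (a' * b')) :=
  exists (T : I -> super a a') (E : I -> super b b'),
    [/\ forall i, CPTP (T i), instrument E
      & forall i rho, G i rho = tens_map (T i) (E i) rho].

(* An outcome of the composed instrument is the list of the outcomes of all
   the rounds; the next round is chosen as a function of it. *)
Inductive locc_rounds (a b : nat) : forall (a' b' : nat) (I : finType),
    (I -> super (a * b) (a' * b')) -> Prop :=
| LoccStart : @locc_rounds a b a b unit (fun _ => id)
| LoccRound (a1 b1 a2 b2 : nat) (I : finType)
    (E : I -> super (a * b) (a1 * b1)) (J : I -> finType)
    (G : forall i, J i -> super (a1 * b1) (a2 * b2)) :
    locc_rounds E ->
    (forall i, one_way_fromA (G i) \/ one_way_fromB (G i)) ->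
    @locc_rounds a b a2 b2 {i : I & J i}
      (fun p => G (tag p) (tagged p) \o E (tag p)).

Definition locc_instrument a b a' b' (K : finType)
    (G : K -> super (a * b) (a' * b')) :=
  exists (I : finType) (E : I -> super (a * b) (a' * b')) (f : I -> K),
    locc_rounds E /\ forall k rho, G k rho = \sum_(i | f i == k) E i rho.

Definition LOCC (a b : nat) : set (super (a * b) (a * b)) :=
  [set F | exists (K : finType) (G : K -> super (a * b) (a * b))
     (s : K -> bool),
     locc_instrument G /\
     forall rho, F rho = \sum_k (-1) ^+ s k *: G k rho].

(* The identification of (a * b) * (c * d) with (a * c) * (b * d) that swaps
   the two middle tensor factors. *)
Definition swap_middle_index a b c d (x : 'I_((a * b) * (c * d))) :
    'I_((a * c) * (b * d)) :=
  let: (y, z) := mxtens_unindex x in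
  let: (i, j) := mxtens_unindex y in
  let: (k, l) := mxtens_unindex z in
  mxtens_index (mxtens_index (i, k), mxtens_index (j, l)).

Definition swap_middle a b c d (rho : 'M[C]_((a * c) * (b * d))) :
    'M[C]_((a * b) * (c * d)) :=
  mxsub (@swap_middle_index a b c d) (@swap_middle_index a b c d) rho.

Section Ancillas.
Variables a b eA eB : nat.

(* The ancillas have dimensions eA.+1 and eB.+1, so that |0> exists. *)
Definition add_ancillas :
    super (a * b) ((a * eA.+1) * (b * eB.+1)) :=
  fun rho => swap_middle
    (rho *t (delta_mx ord0 ord0 *t delta_mx ord0 ord0
             : 'M[C]_(eA.+1 * eB.+1))).

Definition trace_ancillas :
    super ((a * eA.+1) * (b * eB.+1)) (a * b) :=
  fun rho => ptrace2 (swap_middle rho : 'M[C]_((a * b) * (eA.+1 * eB.+1))).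

Definition extend_box (X : super (a * b) (a * b)) :
    super ((a * eA.+1) * (b * eB.+1)) ((a * eA.+1) * (b * eB.+1)) :=
  fun rho => swap_middle
    (tens_map X (@id 'M[C]_(eA.+1 * eB.+1)) (swap_middle rho)).

End Ancillas.

Definition bipartite_class := forall a b : nat, set (super (a * b) (a * b)).

Definition blackbox_costs (S : bipartite_class) a b
    (E1 E2 : super (a * b) (a * b)) : set R :=
  [set c | exists (eA eB m : nat) (q : 'I_m -> R)
     (F G : 'I_m -> super ((a * eA.+1) * (b * eB.+1))
                          ((a * eA.+1) * (b * eB.+1))),
     [/\ (0 < m)%N,
         forall i, S _ _ (F i) /\ S _ _ (G i),
         forall X : super (a * b) (a * b), CPTP X -> forall rho,
           E1 (X (E2 rho)) =
           trace_ancillas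
             (\sum_i (q i)%:C *: F i (extend_box X (G i (add_ancillas eA eB rho))))
       & c = \sum_i `|q i|]].

Definition blackbox_gamma (S : bipartite_class) a b
    (E1 E2 : super (a * b) (a * b)) : R :=
  inf (blackbox_costs S E1 E2).

(* The infimum is attained, i.e. it is a minimum. *)
Definition has_optimal_decomposition (S : bipartite_class) a b
    (E1 E2 : super (a * b) (a * b)) : Prop :=
  blackbox_costs S E1 E2 (blackbox_gamma S E1 E2).

End Maps.

Section Qubits.
Variable R : realType.
Local Notation C := R[i].

Definition unitary_channel n (U : 'M[C]_n) : super R n n :=
  fun rho => U *m rho *m U ^t*.

(* A basis state of n qubits is a number x < 2 ^ n, the k-th qubit being its
   k-th binary digit. *)
Definition qubit n (x : 'I_(2 ^ n)) (k : 'I_n) : 'I_2 :=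
  inord (odd (x %/ 2 ^ k)).

Definition agree_off n (i : 'I_n) (x y : 'I_(2 ^ n)) :=
  [forall k, (k != i) ==> (qubit x k == qubit y k)].

(* The two-qubit gate U on qubit i of A and qubit j of B, tensored with the
   identity on all the other qubits. *)
Definition gate_on nA nB (i : 'I_nA) (j : 'I_nB) (U : 'M[C]_(2 * 2)) :
    'M[C]_(2 ^ nA * 2 ^ nB) :=
  \matrix_(x, y)
    let: (xA, xB) := mxtens_unindex x in
    let: (yA, yB) := mxtens_unindex y in
    if agree_off i xA yA && agree_off j xB yB
    then U (mxtens_index (qubit xA i, qubit xB j))
           (mxtens_index (qubit yA i, qubit yB j))
    else 0.

Definition mx2 (p q r s : C) : 'M[C]_2 :=
  \matrix_(i, j) if i == 0 then (if j == 0 then p else q)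
                 else (if j == 0 then r else s).

Definition pauli (k : 'I_4) : 'M[C]_2 :=
  nth 0 [:: mx2 1 0 0 1; mx2 0 1 1 0; mx2 0 (- 'i) 'i 0; mx2 1 0 0 (-1)] k.

Definition is_KAK (U : 'M[C]_(2 * 2)) (u : 'I_4 -> C) :=
  \sum_k normc (u k) ^+ 2 = 1 /\
  exists V1 V2 V3 V4 : 'M[C]_2,
    [/\ V1 \is unitarymx, V2 \is unitarymx, V3 \is unitarymx,
        V4 \is unitarymx
      & U = (V1 *t V2) *m (\sum_k u k *: (pauli k *t pauli k))
                       *m (V3 *t V4)].

End Qubits.

(* Main.v *)
(* Write each gate as a combination of tensor products of local unitaries, with
   coefficients u k and v k.

   Lower bound: take for the black box a permutation of the qubits of each party
   that moves the qubit of the first gate away from that of the second. The left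
   side is then a parallel gate with operator-Schmidt coefficients w k, and each
   map on the right is a difference of separable maps
   whose sum is trace preserving. A separable map of weight t overlaps with the
   maximally entangled operator in the Schmidt frame by at most t, and the gate
   overlaps with it by (\sum_k |w k|)^2, so the positive part of the
   decomposition weighs at least that much and the negative part that minus one.

   Upper bound: expand the two gates into terms
   w x (w y)^* (K x) X((L x) rho (L y)^* ) (K y)^*. The diagonal ones are local
   unitaries. For x <> y each party holds an ancilla qubit in superposition that
   selects x or y both before and after the black box, and a signed measurement of
   the ancillas in one of two pairs of equatorial bases extracts the term plus its
   adjoint. *)
Require Import Defs.
From mathcomp Require Import all_boot all_order all_algebra.
From mathcomp Require Import classical_sets reals.
From mathcomp Require Import complex mxtens.
From mathcomp Require Import fingroup perm ring.

Set Implicit Arguments.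
Unset Strict Implicit.
Unset Printing Implicit Defensive.

Import Order.TTheory GRing.Theory Num.Theory.
Local Open Scope ring_scope.
Local Open Scope sesquilinear_scope.

(** * Kraus operators *)

(** Once the black box is fixed and is itself a product of local unitaries, each term of a
    decomposition, from the preparation of the ancillas to the final partial trace, is a single map
    on A B. Of LOCC only two facts are kept: the Kraus operators are products, and forgetting the
    signs leaves a trace preserving map. Both survive composition.

    The identity box would not do as a test: two gates on the same pair of qubits may cancel there,
    and their product then says nothing about the cost. Separating them takes a second qubit on each
    side.

    The bounds meet because the [w k] are normalised: with s the sum of the [|w k|], both equal 2
    s^2 - 1. In the construction a diagonal term costs [|w x|^2], while an ordered off-diagonal pair
    costs [2 |w x| |w y|]. The factor 2 is the price of two measurement settings: a single setting
    also picks up the terms in which the two parties sit in different branches. *)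

Section LinearFunctions.
Variables (K : nzRingType) (U V : lmodType K) (f : U -> V).
Hypothesis f_lin : linear f.

Lemma linear_fun0 : f 0 = 0.
Proof. by have := f_lin (-1) 0 0; rewrite scaler0 addr0 scaleN1r addNr. Qed.

Lemma linear_funZ a x : f (a *: x) = a *: f x.
Proof. by have := f_lin a x 0; rewrite linear_fun0 !addr0. Qed.

Lemma linear_funD x y : f (x + y) = f x + f y.
Proof. by have := f_lin 1 x y; rewrite !scale1r. Qed.

Lemma linear_fun_sum (I : Type) (s : seq I) (P : pred I) (F : I -> U) :
  f (\sum_(i <- s | P i) F i) = \sum_(i <- s | P i) f (F i).
Proof. exact: (big_morph f linear_funD linear_fun0). Qed.

End LinearFunctions.

Section ConjugateTranspose.
Variable C : numClosedFieldType.

Lemma adjmx_mul m n p (A : 'M[C]_(m, n)) (B : 'M[C]_(n, p)) :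
  (A *m B) ^t* = B ^t* *m A ^t*.
Proof. by rewrite trmx_mul map_mxM. Qed.

Lemma adjmx_tens m n p q (A : 'M[C]_(m, n)) (B : 'M[C]_(p, q)) :
  (A *t B) ^t* = A ^t* *t B ^t*.
Proof. by rewrite trmx_tens map_mxT. Qed.

Lemma adjmxD m n (A B : 'M[C]_(m, n)) : (A + B) ^t* = A ^t* + B ^t*.
Proof. by rewrite linearD map_mxD. Qed.

Lemma adjmxZ m n a (A : 'M[C]_(m, n)) : (a *: A) ^t* = a^* *: A ^t*.
Proof. by rewrite linearZ map_mxZ. Qed.

Lemma adjmx_sum m n (I : Type) (s : seq I) (P : pred I) (F : I -> 'M[C]_(m, n)) :
  (\sum_(i <- s | P i) F i) ^t* = \sum_(i <- s | P i) (F i) ^t*.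
Proof. by rewrite linear_sum map_mx_sum. Qed.

Lemma adjmx1 n : (1%:M : 'M[C]_n) ^t* = 1%:M.
Proof. by rewrite tr_scalar_mx map_scalar_mx /= conjC1. Qed.

Lemma unitarymx_adjl n (A : 'M[C]_n) : A \is unitarymx -> A ^t* *m A = 1%:M.
Proof. by move=> uA; rewrite -invmx_unitary// mulVmx// unitarymx_unit. Qed.

(** Only the diagonal of the sesquilinear form is known to be real. Polarisation at [v + w] and
    [v + 'i *: w] makes [rho] Hermitian, so the spectral theorem applies; the vectors are
    eigenvectors scaled by the square roots of the eigenvalues. *)
Lemma posdef_sum_outer n (rho : 'M[C]_n) :
  (forall v : 'cV[C]_n, 0 <= (v ^t* *m rho *m v) 0 0) ->
  exists v : 'I_n -> 'cV[C]_n, rho = \sum_i v i *m (v i) ^t*.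
Proof.
move=> rho_psd.
have form_herm (v w : 'cV[C]_n) : (v ^t* *m rho *m w) 0 0 = ((w ^t* *m rho *m v) 0 0)^*.
  pose q (x y : 'cV[C]_n) : C := (x ^t* *m rho *m y) 0 0.
  have qD x x' y : q (x + x') y = q x y + q x' y.
    by rewrite /q adjmxD !mulmxDl mxE.
  have qDr x y y' : q x (y + y') = q x y + q x y'.
    by rewrite /q mulmxDr mxE.
  have qZ a x y : q (a *: x) y = a^* * q x y.
    by rewrite /q adjmxZ -!scalemxAl mxE.
  have qZr a x y : q x (a *: y) = a * q x y.
    by rewrite /q -scalemxAr mxE.
  have qreal x : (q x x)^* = q x x by apply/CrealP/ger0_real/rho_psd.
  have := qreal (v + w); have := qreal (v + 'i *: w).
  rewrite !(qD, qDr, qZ, qZr) !rmorphD /= !rmorphM /= !conjCK !qreal conjCi.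
  rewrite -/(q v w) -/(q w v); move: (q v w) (q w v) (q v v) (q w w) => x y z t.
  move=> /eqP; rewrite -subr_eq0 => /eqP e1 /eqP; rewrite -subr_eq0 => /eqP e2.
  have i2 : 'i * 'i = -1 :> C by rewrite -expr2 sqrCi.
  have e1' : 'i * (y^* - x^* - x + y) = 0.
    rewrite -{}e1; have E (a b c x0 y0 z0 t0 : C) : c * (b - a - x0 + y0) =
      z0 + - c * a + (c * b + c * (- c * t0)) -
      (z0 + c * x0 + (- c * y0 + - c * (c * t0))) by ring.
    exact: E.
  have e3 : y^* - x^* - x + y = 0.
    by move/eqP: e1'; rewrite mulf_eq0 (negPf (neq0Ci _)) => /eqP.
  have e4 : 2 * (x^* - y) = 0.
    rewrite -[0]subr0 -{1}e2 -e3.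
    have E (a b x0 y0 z0 t0 : C) : 2 * (a - y0) =
      z0 + a + (b + t0) - (z0 + x0 + (y0 + t0)) - (b - a - x0 + y0) by ring.
    exact: E.
  move/eqP: e4; rewrite mulf_eq0 pnatr_eq0 subr_eq0 => /eqP <-.
  by rewrite conjCK.
have rho_herm : rho \is hermsymmx.
  apply/is_hermitianmxP; rewrite expr0 scale1r; apply/matrixP => i j.
  have := form_herm (delta_mx i 0) (delta_mx j 0).
  have E k l : ((delta_mx k (0 : 'I_1)) ^t* *m rho *m delta_mx l (0 : 'I_1)) 0 0 = rho k l.
    rewrite trmx_delta map_delta_mx -rowE -colE !mxE //.
  by rewrite !E !mxE.
have rho_normal := hermitian_normalmx rho_herm.
pose P := spectralmx rho; pose d := spectral_diag rho.
have uP : P \is unitarymx by exact: spectral_unitarymx.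
have rhoE : rho = P ^t* *m diag_mx d *m P.
  by rewrite -invmx_unitary//; exact/orthomx_spectralP.
have d_ge0 i : 0 <= d 0 i.
  have := rho_psd (P ^t* *m delta_mx i 0).
  rewrite adjmx_mul trmxCK rhoE !mulmxA.
  rewrite -[_ *m P *m P^t*]mulmxA (unitarymxP uP) mulmx1.
  rewrite -[_ *m P *m P^t*]mulmxA (unitarymxP uP) mulmx1.
  by rewrite trmx_delta map_delta_mx -rowE -colE !mxE eqxx mulr1n.
exists (fun i => sqrtC (d 0 i) *: (row i P) ^t*).
rewrite rhoE mul_mx_diag; apply/matrixP => x y; rewrite summxE !mxE.
apply: eq_bigr => i _; rewrite !mxE big_ord1 !mxE rmorphM /= conjCK.
have -> : (sqrtC (d 0 i))^* = sqrtC (d 0 i).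
  by apply/CrealP/ger0_real; rewrite sqrtC_ge0.
rewrite -[in LHS](sqrtCK (d 0 i)) expr2.
have E (a b c : C) : a * (b * b) * c = b * a * (b * c) by ring.
exact: E.
Qed.

End ConjugateTranspose.

Section TensorProducts.
Variable K : comNzRingType.

Lemma tensmxDl m n p q (A A' : 'M[K]_(m, n)) (B : 'M[K]_(p, q)) :
  (A + A') *t B = A *t B + A' *t B.
Proof. by apply/matrixP => i j; rewrite !mxE mulrDl. Qed.

Lemma tensmxDr m n p q (A : 'M[K]_(m, n)) (B B' : 'M[K]_(p, q)) :
  A *t (B + B') = A *t B + A *t B'.
Proof. by apply/matrixP => i j; rewrite !mxE mulrDr. Qed.

Lemma tensmxZl m n p q a (A : 'M[K]_(m, n)) (B : 'M[K]_(p, q)) :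
  (a *: A) *t B = a *: (A *t B).
Proof. by apply/matrixP => i j; rewrite !mxE mulrA. Qed.

Lemma tensmxZr m n p q a (A : 'M[K]_(m, n)) (B : 'M[K]_(p, q)) :
  A *t (a *: B) = a *: (A *t B).
Proof. by apply/matrixP => i j; rewrite !mxE mulrCA. Qed.

Lemma tensmxBl m n p q (A A' : 'M[K]_(m, n)) (B : 'M[K]_(p, q)) :
  (A - A') *t B = A *t B - A' *t B.
Proof. by apply/matrixP => i j; rewrite !mxE mulrBl. Qed.

Lemma tensmxBr m n p q (A : 'M[K]_(m, n)) (B B' : 'M[K]_(p, q)) :
  A *t (B - B') = A *t B - A *t B'.
Proof. by apply/matrixP => i j; rewrite !mxE mulrBr. Qed.

Lemma tensmx_suml m n p q (I : Type) (s : seq I) (F : I -> 'M[K]_(m, n))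
    (B : 'M[K]_(p, q)) :
  (\sum_(i <- s) F i) *t B = \sum_(i <- s) F i *t B.
Proof.
elim: s => [|i s IH]; first by rewrite !big_nil tens0mx.
by rewrite !big_cons tensmxDl IH.
Qed.

Lemma tensmx_sumr m n p q (I : Type) (s : seq I) (A : 'M[K]_(m, n))
    (F : I -> 'M[K]_(p, q)) :
  A *t (\sum_(i <- s) F i) = \sum_(i <- s) A *t F i.
Proof.
elim: s => [|i s IH]; first by rewrite !big_nil tensmx0.
by rewrite !big_cons tensmxDr IH.
Qed.

Lemma mxtens_index_eq m n (x y : 'I_m * 'I_n) :
  (mxtens_index x == mxtens_index y) = (x == y).
Proof. by rewrite (inj_eq (can_inj (@mxtens_indexK m n))). Qed.

Lemma tensmx1 m n : (1%:M : 'M[K]_m) *t (1%:M : 'M[K]_n) = 1%:M.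
Proof.
apply/matrixP => i j; case: (mxtens_indexP i) => i1 i2.
case: (mxtens_indexP j) => j1 j2; rewrite tensmxE !mxE mxtens_index_eq.
by rewrite xpair_eqE -natrM mulnb.
Qed.

Lemma sum_mxtens_index m n (V : nmodType) (F : 'I_(m * n) -> V) :
  \sum_i F i = \sum_j \sum_k F (mxtens_index (j, k)).
Proof.
rewrite pair_bigA (reindex (@mxtens_index m n)) /=; first by apply: eq_bigr; case.
by exists (@mxtens_unindex m n) => i _; rewrite (mxtens_indexK, mxtens_unindexK).
Qed.

Lemma mxtrace_tens m n (A : 'M[K]_m) (B : 'M[K]_n) :
  \tr (A *t B) = \tr A * \tr B.
Proof.
rewrite /mxtrace sum_mxtens_index mulr_suml; apply: eq_bigr => i _.
by rewrite mulr_sumr; apply: eq_bigr => j _; rewrite tensmxE.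
Qed.

End TensorProducts.

Section CompletelyPositive.
Variable R : realType.
Local Notation C := R[i].

Definition krausmap m n (A : 'M[C]_(n, m)) : super R m n :=
  fun rho => A *m rho *m A ^t*.

Lemma krausmap_linear m n (A : 'M[C]_(n, m)) : linear (krausmap A).
Proof.
by move=> a x y; rewrite /krausmap mulmxDr mulmxDl -scalemxAr -scalemxAl.
Qed.

Lemma krausmap_comp m n p (A : 'M[C]_(n, m)) (B : 'M[C]_(p, n)) rho :
  krausmap B (krausmap A rho) = krausmap (B *m A) rho.
Proof. by rewrite /krausmap adjmx_mul !mulmxA. Qed.

Lemma krausmap1 m rho : krausmap (1%:M : 'M[C]_m) rho = rho.
Proof. by rewrite /krausmap adjmx1 mul1mx mulmx1. Qed.

Lemma krausmap_tens m n p q (A : 'M[C]_(n, m)) (B : 'M[C]_(q, p)) s t :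
  krausmap (A *t B) (s *t t) = krausmap A s *t krausmap B t.
Proof. by rewrite /krausmap adjmx_tens !tensmx_mul. Qed.

Lemma krausmap_psd m n (A : 'M[C]_(n, m)) rho : psd rho -> psd (krausmap A rho).
Proof.
move=> rho_psd v; have := rho_psd (A ^t* *m v).
by rewrite adjmx_mul trmxCK /krausmap !mulmxA.
Qed.

Lemma mxtrace_krausmap m n (A : 'M[C]_(n, m)) rho :
  \tr (krausmap A rho) = \tr (A ^t* *m A *m rho).
Proof. by rewrite /krausmap mxtrace_mulC mulmxA. Qed.

Lemma mx_sum_block m p (rho : 'M[C]_(m * p)) :
  rho = \sum_i \sum_j delta_mx i j *t block rho i j.
Proof.
apply/matrixP => x y; case: (mxtens_indexP x) => i k.
case: (mxtens_indexP y) => j l; rewrite summxE (bigD1 i)//= summxE (bigD1 j)//=.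
rewrite tensmxE !mxE !eqxx mul1r big1 ?addr0 => [|j' nj]; last first.
  by rewrite tensmxE !mxE eqxx (eq_sym j) (negPf nj) mul0r.
rewrite big1 ?addr0// => i' ni; rewrite summxE big1// => j' _.
by rewrite tensmxE !mxE (eq_sym i) (negPf ni) mul0r.
Qed.

Lemma block_linear m p (i j : 'I_m) : linear (fun rho : 'M[C]_(m * p) => block rho i j).
Proof. by move=> a x y; apply/matrixP => k l; rewrite !mxE. Qed.

Lemma block_tens m p (s : 'M[C]_m) (t : 'M[C]_p) i j :
  block (s *t t) i j = s i j *: t.
Proof. by apply/matrixP => k l; rewrite mxE tensmxE !mxE. Qed.

Lemma tens_map_tens m n p q (f : super R m n) (g : super R p q) s t :
  linear f -> linear g -> tens_map f g (s *t t) = f s *t g t.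
Proof.
move=> lf lg; rewrite [in RHS](matrix_sum_delta s) (linear_fun_sum lf).
rewrite tensmx_suml; apply: eq_bigr => i _.
rewrite (linear_fun_sum lf) tensmx_suml; apply: eq_bigr => j _.
by rewrite block_tens (linear_funZ lg) (linear_funZ lf) tensmxZl tensmxZr.
Qed.

Lemma tens_map_linear m n p q (f : super R m n) (g : super R p q) :
  linear g -> linear (tens_map f g).
Proof.
move=> lg a x y; rewrite /tens_map scaler_sumr -big_split; apply: eq_bigr => i _.
rewrite /= scaler_sumr -big_split; apply: eq_bigr => j _.
by rewrite block_linear lg tensmxDr tensmxZr.
Qed.

Lemma eq_linear_tens m p (V : lmodType C) (f g : 'M[C]_(m * p) -> V) :
  linear f -> linear g -> (forall s t, f (s *t t) = g (s *t t)) -> f =1 g.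
Proof.
move=> lf lg fg rho; rewrite [rho]mx_sum_block.
rewrite (linear_fun_sum lf) (linear_fun_sum lg); apply: eq_bigr => i _.
by rewrite (linear_fun_sum lf) (linear_fun_sum lg); apply: eq_bigr => j _.
Qed.

Lemma sum_linear (U V : lmodType C) (I : Type) (s : seq I) (P : pred I)
    (F : I -> U -> V) :
  (forall i, linear (F i)) -> linear (fun x => \sum_(i <- s | P i) F i x).
Proof.
move=> lF a x y; rewrite scaler_sumr -big_split; apply: eq_bigr => i _.
exact: lF.
Qed.

Lemma comp_linear (U V W : lmodType C) (f : V -> W) (g : U -> V) :
  linear f -> linear g -> linear (f \o g).
Proof. by move=> lf lg a x y; rewrite /= lg lf. Qed.

Lemma eq_linear_tens4 m n p q (V : lmodType C)
    (f g : 'M[C]_((m * n) * (p * q)) -> V) :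
  linear f -> linear g ->
  (forall s t u v, f ((s *t t) *t (u *t v)) = g ((s *t t) *t (u *t v))) ->
  f =1 g.
Proof.
move=> lf lg fg; apply: eq_linear_tens => // x y.
apply: (@eq_linear_tens _ _ _ (fun x => f (x *t y)) (fun x => g (x *t y)))
  => [c x1 x2|c x1 x2|s t].
- by rewrite tensmxDl tensmxZl lf.
- by rewrite tensmxDl tensmxZl lg.
apply: (@eq_linear_tens _ _ _ (fun y => f (s *t t *t y)) (fun y => g (s *t t *t y)))
  => [c x1 x2|c x1 x2|u v] //.
- by rewrite tensmxDr tensmxZr lf.
- by rewrite tensmxDr tensmxZr lg.
Qed.

Lemma tens_map_krausmap m n p q (A : 'M[C]_(n, m)) (B : 'M[C]_(q, p)) rho :
  tens_map (krausmap A) (krausmap B) rho = krausmap (A *t B) rho.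
Proof.
move: rho; apply: eq_linear_tens; try exact: krausmap_linear.
  exact/tens_map_linear/krausmap_linear.
move=> s t; rewrite tens_map_tens; try exact: krausmap_linear.
by rewrite krausmap_tens.
Qed.

Lemma tens_map_id m p rho : tens_map (@id 'M[C]_m) (@id 'M[C]_p) rho = rho.
Proof. by rewrite [RHS]mx_sum_block. Qed.

Lemma krausmap_CP m n (A : 'M[C]_(n, m)) : CP (krausmap A).
Proof.
split=> [|k rho rho_psd]; first exact: krausmap_linear.
suff -> : tens_map id (krausmap A) rho = krausmap (1%:M *t A) rho.
  exact: krausmap_psd.
rewrite -tens_map_krausmap; apply: eq_bigr => i _; apply: eq_bigr => j _.
by rewrite krausmap1.
Qed.

Lemma unitary_channel_CPTP n (A : 'M[C]_n) :
  A \is unitarymx -> CPTP (unitary_channel A).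
Proof.
move=> uA; split; first exact: krausmap_CP.
by move=> rho; rewrite mxtrace_krausmap unitarymx_adjl// mul1mx.
Qed.

Lemma id_CPTP n : CPTP (@id 'M[C]_n).
Proof. by split=> //; split=> // k rho; rewrite (tens_map_id rho). Qed.

(* The operators are read off a Gram decomposition of the Choi matrix of f. *)
Lemma CP_kraus m n (f : super R m n) :
  CP f -> exists s : seq 'M[C]_(n, m), forall rho, f rho = \sum_(A <- s) krausmap A rho.
Proof.
case=> lf f_pos.
(* The unnormalised maximally entangled vector: the blocks of its outer product are the matrix
   units, so applying [f] to the second factor records all values of [f] on them. *)
pose w : 'cV[C]_(m * m) := \col_x ((mxtens_unindex x).1 == (mxtens_unindex x).2)%:R.
have w_psd : psd (w *m w ^t*).
  move=> v; rewrite mulmxA -mulmxA.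
  have -> : w ^t* *m v = (v ^t* *m w) ^t* by rewrite adjmx_mul trmxCK.
  by rewrite mxE big_ord1 !mxE mul_conjC_ge0.
have [v vE] := posdef_sum_outer (f_pos m _ w_psd).
exists [seq \matrix_(p, i) v l (mxtens_index (i, p)) 0 | l <- enum 'I_(m * n)].
move=> rho; rewrite big_map big_enum /=.
have lk : linear (fun rho =>
    \sum_l krausmap (\matrix_(p, i) v l (mxtens_index (i, p)) 0) rho).
  by apply: sum_linear => l; exact: krausmap_linear.
rewrite [rho]matrix_sum_delta (linear_fun_sum lf) (linear_fun_sum lk).
apply: eq_bigr => i _; rewrite (linear_fun_sum lf) (linear_fun_sum lk).
apply: eq_bigr => j _; rewrite (linear_funZ lf) (linear_funZ lk); congr (_ *: _).
have blockE k l : block (w *m w ^t*) k l = delta_mx k l.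
  apply/matrixP => p q; rewrite !mxE big_ord1 !mxE !mxtens_indexK /=.
  by rewrite rmorph_nat -natrM mulnb (eq_sym p) (eq_sym q).
apply/matrixP => p q.
have := congr1 (fun M : 'M_(m * n) => M (mxtens_index (i, p)) (mxtens_index (j, q))) vE.
rewrite /tens_map summxE (bigD1 i)//= summxE (bigD1 j)//= tensmxE mxE !eqxx mul1r.
rewrite blockE big1 ?addr0 => [|j' nj]; last first.
  by rewrite tensmxE !mxE eqxx (eq_sym j) (negPf nj) mul0r.
rewrite big1 ?addr0 => [|i' ni]; last first.
  rewrite summxE big1// => j' _.
  by rewrite tensmxE !mxE (eq_sym i) (negPf ni) mul0r.
move=> ->; rewrite !summxE; apply: eq_bigr => l _.
rewrite /krausmap -(mul_delta_mx (0 : 'I_1)) mulmxA -colE.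
rewrite -mulmxA -rowE mxE [RHS]mxE !big_ord1 !mxE.
by congr (_ * _).
Qed.

End CompletelyPositive.

(** * Qubit registers *)

Section QubitRegister.
Variable R : realType.
Local Notation C := R[i].

Lemma eq_from_binary_digits n x y : (x < 2 ^ n)%N -> (y < 2 ^ n)%N ->
  (forall k, (k < n)%N -> odd (x %/ 2 ^ k) = odd (y %/ 2 ^ k)) -> x = y.
Proof.
elim: n x y => [|n IH] x y.
  by rewrite expn0 !ltnS !leqn0 => /eqP-> /eqP->.
move=> xlt ylt xy; rewrite -(odd_double_half x) -(odd_double_half y).
have := xy 0%N isT; rewrite expn0 !divn1 => ->; congr (_ + _.*2)%N.
apply: IH; rewrite -?divn2 ?ltn_divLR// ?[(_ * 2)%N]mulnC -?expnS//.
by move=> k kn; rewrite -!divnMA -expnS xy.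
Qed.

Lemma eq_from_qubits n (x y : 'I_(2 ^ n)) : qubit x =1 qubit y -> x = y.
Proof.
move=> xy; apply: val_inj.
apply: (@eq_from_binary_digits n _ _ (ltn_ord x) (ltn_ord y)) => k kn.
have /(congr1 val) := xy (Ordinal kn); rewrite /= !inordK ?ltnS ?leq_b1//.
by case: (odd _); case: (odd _).
Qed.

(** Injectivity suffices since both sides have 2^n elements. Sums over basis states become sums over
    assignments of bits, so sums of products factor over the qubits. *)
Lemma qubits_bij n : bijective (fun x : 'I_(2 ^ n) => [ffun k => qubit x k]).
Proof.
apply: inj_card_bij => [x y /ffunP xy|].
  by apply: eq_from_qubits => k; have := xy k; rewrite !ffunE.
by rewrite card_ffun !card_ord.
Qed.

Lemma sum_prod_qubits n (F : 'I_n -> 'I_2 -> C) :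
  \sum_(x : 'I_(2 ^ n)) \prod_k F k (qubit x k) = \prod_k \sum_c F k c.
Proof.
rewrite bigA_distr_bigA (reindex _ (onW_bij _ (qubits_bij n))) /=.
by apply: eq_bigr => x _; apply: eq_bigr => k _; rewrite ffunE.
Qed.

Lemma prod_qubits_eq n (x y : 'I_(2 ^ n)) :
  \prod_k (qubit x k == qubit y k)%:R = (x == y)%:R :> C.
Proof.
have [->|nxy] := eqVneq x y; first by rewrite big1// => k _; rewrite eqxx.
have [k nk] : exists k, qubit x k != qubit y k.
  apply/existsP; rewrite -negb_forall; apply: contra nxy => /forallP xy.
  by apply/eqP/eq_from_qubits => k; exact/eqP.
by rewrite (bigD1 k)//= (negPf nk) mul0r.
Qed.

(** The tensor product of the [W k] over all qubits, given by its entries because the register is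
    the flat type ['I_(2 ^ n)]. *)
Definition site_mx n (W : 'I_n -> 'M[C]_2) : 'M[C]_(2 ^ n) :=
  \matrix_(x, y) \prod_k W k (qubit x k) (qubit y k).

Lemma eq_site_mx n (W W' : 'I_n -> 'M[C]_2) : W =1 W' -> site_mx W = site_mx W'.
Proof.
by move=> WW; apply/matrixP => x y; rewrite !mxE; apply: eq_bigr => k _; rewrite WW.
Qed.

Lemma site_mx_mul n (W W' : 'I_n -> 'M[C]_2) :
  site_mx W *m site_mx W' = site_mx (fun k => W k *m W' k).
Proof.
apply/matrixP => x z; rewrite !mxE.
pose F k c := W k (qubit x k) c * W' k c (qubit z k).
rewrite [LHS](_ : _ = \sum_y \prod_k F k (qubit y k)); last first.
  by apply: eq_bigr => y _; rewrite !mxE -big_split.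
by rewrite sum_prod_qubits; apply: eq_bigr => k _; rewrite mxE.
Qed.

Lemma site_mx_adj n (W : 'I_n -> 'M[C]_2) :
  (site_mx W) ^t* = site_mx (fun k => (W k) ^t*).
Proof.
by apply/matrixP => x y; rewrite !mxE rmorph_prod; apply: eq_bigr => k _; rewrite !mxE.
Qed.

Lemma site_mx1 n : site_mx (fun _ : 'I_n => 1%:M) = 1%:M.
Proof.
apply/matrixP => x y; rewrite !mxE -prod_qubits_eq.
by apply: eq_bigr => k _; rewrite mxE.
Qed.

Lemma mxtrace_site_mx n (W : 'I_n -> 'M[C]_2) : \tr (site_mx W) = \prod_k \tr (W k).
Proof.
rewrite /mxtrace -(sum_prod_qubits (fun k c => W k c c)).
by apply: eq_bigr => x _; rewrite mxE.
Qed.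

Definition one_qubit n (i : 'I_n) (W : 'M[C]_2) :=
  site_mx (fun k => if k == i then W else 1%:M).

Lemma one_qubitE n (i : 'I_n) W x y :
  one_qubit i W x y =
  if agree_off i x y then W (qubit x i) (qubit y i) else 0.
Proof.
rewrite mxE (bigD1 i)//= eqxx; case: ifP => [/forallP xy|/negbT].
  rewrite big1 ?mulr1// => k ki.
  by rewrite (negPf ki) mxE; have := xy k; rewrite ki => /eqP->; rewrite eqxx.
rewrite negb_forall => /existsP[k]; rewrite negb_imply => /andP[ki xyk].
by rewrite (bigD1 k)//= (negPf ki) mxE (negPf xyk) mul0r mulr0.
Qed.

Lemma one_qubit_mul n (i : 'I_n) W W' :
  one_qubit i W *m one_qubit i W' = one_qubit i (W *m W').
Proof.
by rewrite site_mx_mul; apply: eq_site_mx => k; case: eqP => //; rewrite mulmx1.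
Qed.

Lemma one_qubit_adj n (i : 'I_n) W : (one_qubit i W) ^t* = one_qubit i (W ^t*).
Proof. by rewrite site_mx_adj; apply: eq_site_mx => k; case: eqP; rewrite ?adjmx1. Qed.

Lemma one_qubit_unitary n (i : 'I_n) W :
  W \is unitarymx -> one_qubit i W \is unitarymx.
Proof.
move=> /unitarymxP uW; apply/unitarymxP.
rewrite one_qubit_adj one_qubit_mul uW -[RHS]site_mx1.
by apply: eq_site_mx => k; case: eqP.
Qed.

Lemma gate_on_tens nA nB (i : 'I_nA) (j : 'I_nB) (S T : 'M[C]_2) :
  gate_on i j (S *t T) = one_qubit i S *t one_qubit j T.
Proof.
apply/matrixP => x y; rewrite mxE.
case: (mxtens_indexP x) => xA xB; case: (mxtens_indexP y) => yA yB.
rewrite !mxtens_indexK tensmxE [RHS]tensmxE !one_qubitE.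
by case: (agree_off i _ _); case: (agree_off j _ _); rewrite /= ?mul0r ?mulr0.
Qed.

Lemma gate_on_sum nA nB (i : 'I_nA) (j : 'I_nB) (I : finType)
    (c : I -> C) (U : I -> 'M[C]_(2 * 2)) :
  gate_on i j (\sum_k c k *: U k) = \sum_k c k *: gate_on i j (U k).
Proof.
apply/matrixP => x y; rewrite summxE mxE.
case: (mxtens_indexP x) => xA xB; case: (mxtens_indexP y) => yA yB.
rewrite !mxtens_indexK; under [RHS]eq_bigr do rewrite !mxE ?mxtens_indexK.
case: ifP => _; first by rewrite summxE; apply: eq_bigr => k _; rewrite mxE.
by rewrite big1// => k _; rewrite mulr0.
Qed.

(** The unitary that permutes the qubits, its entries again products over qubits. An operator that
    passes from its right to its left moves from the site [s k] to the site [k]. *)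
Definition qubit_perm_mx n (s : 'S_n) : 'M[C]_(2 ^ n) :=
  \matrix_(x, y) \prod_k (qubit x k == qubit y (s k))%:R.

Lemma sum_prod_qubits_perm n (s : 'S_n) (F : 'I_n -> 'I_2 -> C) :
  \sum_(x : 'I_(2 ^ n)) \prod_k F k (qubit x (s k)) = \prod_k \sum_c F k c.
Proof.
transitivity (\sum_(x : 'I_(2 ^ n)) \prod_k F (s^-1%g k) (qubit x k)).
  apply: eq_bigr => x _; rewrite [RHS](reindex_inj (@perm_inj _ s)) /=.
  by apply: eq_bigr => k _; rewrite permK.
rewrite (sum_prod_qubits (fun k => F (s^-1%g k))) (reindex_inj (@perm_inj _ s)) /=.
by apply: eq_bigr => k _; rewrite permK.
Qed.

Lemma qubit_perm_mx_unitary n (s : 'S_n) : qubit_perm_mx s \is unitarymx.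
Proof.
apply/unitarymxP/matrixP => x z; rewrite !mxE -prod_qubits_eq.
pose F k c : C := (qubit x k == c)%:R * (qubit z k == c)%:R.
rewrite [LHS](_ : _ = \sum_y \prod_k F k (qubit y (s k))); last first.
  apply: eq_bigr => y _; rewrite !mxE rmorph_prod -big_split.
  by apply: eq_bigr => k _; rewrite /= conjC_nat.
rewrite sum_prod_qubits_perm; apply: eq_bigr => k _.
rewrite (bigD1 (qubit x k))//= /F eqxx mul1r eq_sym big1 ?addr0// => c.
by rewrite eq_sym => /negPf->; rewrite mul0r.
Qed.

Lemma site_mx_qubit_perm n (s : 'S_n) (W W' : 'I_n -> 'M[C]_2) :
  (forall k, W' (s k) = W k) ->
  site_mx W *m qubit_perm_mx s = qubit_perm_mx s *m site_mx W'.
Proof.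
move=> WW'; apply/matrixP => x z; rewrite !mxE.
pose F k c := W k (qubit x k) c * (c == qubit z (s k))%:R.
rewrite [LHS](_ : _ = \sum_y \prod_k F k (qubit y k)); last first.
  by apply: eq_bigr => y _; rewrite !mxE -big_split.
pose G k c := (qubit x k == c)%:R * W' (s k) c (qubit z (s k)).
rewrite [RHS](_ : _ = \sum_y \prod_k G k (qubit y (s k))); last first.
  apply: eq_bigr => y _; rewrite !mxE.
  by rewrite [X in _ * X](reindex_inj (@perm_inj _ s)) -big_split.
rewrite sum_prod_qubits sum_prod_qubits_perm; apply: eq_bigr => k _.
rewrite (bigD1 (qubit z (s k)))//= /F eqxx mulr1 big1 ?addr0; last first.
  by move=> c /negPf->; rewrite mulr0.
rewrite (bigD1 (qubit x k))//= /G eqxx mul1r big1 ?addr0 ?WW'// => c.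
by rewrite eq_sym => /negPf->; rewrite mul0r.
Qed.

(* Permuting the qubits between the two gates moves the first one away from the
   second one, so that the two operators act in parallel. *)
Lemma one_qubit_parallel n (i j : 'I_n) : (1 < n)%N ->
  exists (P : 'M[C]_(2 ^ n)) (c : C), P \is unitarymx /\
  forall S S' T T' : 'M[C]_2,
    \tr ((one_qubit i S *m P *m one_qubit j S') ^t*
         *m (one_qubit i T *m P *m one_qubit j T')) =
    \tr (S ^t* *m T) * \tr (S' ^t* *m T') * c.
Proof.
move=> n1; have [s sij] : exists s : 'S_n, s i != j.
  have [<-|nij] := eqVneq i j; last by exists 1%g; rewrite perm1.
  have [l li] : exists l : 'I_n, l != i.
    apply/existsP; rewrite -negb_forall; apply/negP => /forallP all_i.
    move: n1; rewrite ltnNge -{1}(card_ord n) => /negP[].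
    by apply/card_le1_eqP => x y _ _; rewrite (eqP (all_i x)) (eqP (all_i y)).
  by exists (tperm i l); rewrite tpermL.
(* Each qubit touched by neither gate contributes the trace 2 of its identity. *)
exists (qubit_perm_mx s), (\prod_(k | (k != s i) && (k != j)) 2); split.
  exact: qubit_perm_mx_unitary.
move=> S S' T T'.
have E (X Y : 'M[C]_2) : one_qubit i X *m qubit_perm_mx s *m one_qubit j Y =
    qubit_perm_mx s *m site_mx (fun k => (if k == s i then X else 1%:M)
                                   *m (if k == j then Y else 1%:M)).
  rewrite (@site_mx_qubit_perm _ _ _ (fun k => if k == s i then X else 1%:M)).
    by rewrite -mulmxA site_mx_mul.
  by move=> k; rewrite (inj_eq perm_inj).
rewrite !E adjmx_mul mulmxA -[X in X *m _]mulmxA.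
rewrite unitarymx_adjl ?qubit_perm_mx_unitary// mulmx1 site_mx_adj site_mx_mul.
rewrite mxtrace_site_mx (bigD1 (s i))//= (bigD1 j) ?(eq_sym j)//= -mulrA.
rewrite !eqxx ?(eq_sym j) (negPf sij) !mulmx1 !mul1mx; congr (_ * (_ * _)).
apply: eq_bigr => k /andP[/negPf-> /negPf->].
by rewrite !(adjmx1, mulmx1) mxtrace1.
Qed.

Lemma pauli_adj (k : 'I_4) : (pauli R k) ^t* = pauli R k.
Proof.
by case: k => [[|[|[|[|//]]]] ?]; apply/matrixP;
   case=> [[|[|//]] ?]; case=> [[|[|//]] ?];
   rewrite !mxE /= ?conjC0 ?conjC1 ?rmorphN ?conjC1 //=; rewrite /GRing.one/=; simpc.
Qed.

Lemma pauli_mul (k : 'I_4) : pauli R k *m pauli R k = 1%:M.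
Proof.
by case: k => [[|[|[|[|//]]]] ?]; apply/matrixP;
   case=> [[|[|//]] ?]; case=> [[|[|//]] ?];
   rewrite !mxE !big_ord_recl big_ord0 !mxE /=; apply/eqP; simpc;
   rewrite ?eq_complex /= ?(mulr0, mul0r, addr0, add0r, mulr1, mul1r, subr0, oppr0);
   rewrite ?(mulN1r, opprK, eqxx).
Qed.

Lemma mxtrace_pauli_mul (k l : 'I_4) : k != l -> \tr (pauli R k *m pauli R l) = 0.
Proof.
by case: k => [[|[|[|[|//]]]] ?]; case: l => [[|[|[|[|//]]]] ?] //= _;
   rewrite /mxtrace !big_ord_recl big_ord0 !mxE !big_ord_recl !big_ord0 !mxE /=;
   apply/eqP; simpc;
   rewrite ?eq_complex /= ?(mulr0, mul0r, addr0, add0r, mulr1, mul1r, subr0, oppr0);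
   rewrite ?(mulN1r, opprK, eqxx, subrr, addNr).
Qed.

End QubitRegister.

(** * Ancillas *)

Section Ancillas.
Variable R : realType.
Local Notation C := R[i].

Lemma swap_middle_tens a b c d (s : 'M[C]_a) (t : 'M[C]_b) (u : 'M[C]_c) (v : 'M[C]_d) :
  swap_middle ((s *t u) *t (t *t v)) = (s *t t) *t (u *t v).
Proof.
apply/matrixP => x y; case: (mxtens_indexP x) => x1 x2; case: (mxtens_indexP y) => y1 y2.
case: (mxtens_indexP x1) => i j; case: (mxtens_indexP x2) => k l.
case: (mxtens_indexP y1) => i' j'; case: (mxtens_indexP y2) => k' l'.
rewrite mxE /swap_middle_index !mxtens_indexK !tensmxE.
by rewrite mulrACA.
Qed.

Lemma swap_middle_linear a b c d : linear (@swap_middle R a b c d).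
Proof. by move=> e x y; apply/matrixP => i j; rewrite !mxE. Qed.

Lemma swap_middle_indexK a b c d :
  cancel (@swap_middle_index a b c d) (@swap_middle_index a c b d).
Proof.
move=> x; case: (mxtens_indexP x) => x1 x2.
case: (mxtens_indexP x1) => i j; case: (mxtens_indexP x2) => k l.
by rewrite /swap_middle_index !mxtens_indexK.
Qed.

Lemma swap_middleK a b c d :
  cancel (@swap_middle R a b c d) (@swap_middle R a c b d).
Proof. by move=> x; apply/matrixP => i j; rewrite !mxE !swap_middle_indexK. Qed.

Lemma mxtrace_swap_middle a b c d rho : \tr (@swap_middle R a b c d rho) = \tr rho.
Proof.
rewrite [RHS](reindex (@swap_middle_index a b c d)) /=; last first.
  by exists (@swap_middle_index a c b d) => x _; rewrite swap_middle_indexK.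
by apply: eq_bigr => i _; rewrite mxE.
Qed.

Lemma swap_middle_mul a b c d x y :
  @swap_middle R a b c d (x *m y) = swap_middle x *m swap_middle y.
Proof.
apply/matrixP => i j; rewrite !mxE (reindex (@swap_middle_index a b c d)) /=; last first.
  by exists (@swap_middle_index a c b d) => z _; rewrite swap_middle_indexK.
by apply: eq_bigr => k _; rewrite !mxE.
Qed.

Lemma swap_middle_adj a b c d x :
  (@swap_middle R a b c d x) ^t* = swap_middle (x ^t*).
Proof. by apply/matrixP => i j; rewrite !mxE. Qed.

Lemma krausmap_swap_middle a b c d x rho :
  krausmap (@swap_middle R a b c d x) (swap_middle rho) = swap_middle (krausmap x rho).
Proof. by rewrite /krausmap swap_middle_adj -!swap_middle_mul. Qed.

Lemma ptrace2_linear a b : linear (@ptrace2 R a b).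
Proof.
move=> e x y; apply/matrixP => i j; rewrite !mxE mulr_sumr -big_split.
by apply: eq_bigr => k _; rewrite !mxE.
Qed.

Lemma ptrace2_tens a b (s : 'M[C]_a) (t : 'M[C]_b) : ptrace2 (s *t t) = \tr t *: s.
Proof.
apply/matrixP => i j; rewrite !mxE /mxtrace mulr_suml.
by apply: eq_bigr => k _; rewrite tensmxE mulrC.
Qed.

Lemma mxtrace_ptrace2 a b (rho : 'M[C]_(a * b)) : \tr (ptrace2 rho) = \tr rho.
Proof.
by rewrite [RHS]sum_mxtens_index; apply: eq_bigr => i _; rewrite mxE.
Qed.

Lemma add_ancillas_linear a b eA eB : linear (@add_ancillas R a b eA eB).
Proof. by move=> c x y; rewrite /add_ancillas tensmxDl tensmxZl swap_middle_linear. Qed.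

Lemma trace_ancillas_linear a b eA eB : linear (@trace_ancillas R a b eA eB).
Proof. by move=> c x y; rewrite /trace_ancillas swap_middle_linear ptrace2_linear. Qed.

Lemma extend_box_linear a b eA eB X : linear (@extend_box R a b eA eB X).
Proof.
move=> c x y; rewrite /extend_box swap_middle_linear.
by rewrite tens_map_linear// swap_middle_linear.
Qed.

Lemma mxtrace_add_ancillas a b eA eB rho : \tr (@add_ancillas R a b eA eB rho) = \tr rho.
Proof.
rewrite mxtrace_swap_middle !mxtrace_tens.
have E n : \tr (delta_mx ord0 ord0 : 'M[C]_n.+1) = 1.
  rewrite /mxtrace (bigD1 ord0)//= mxE eqxx big1 ?addr0// => i /negPf ni.
  by rewrite mxE ni.
by rewrite !E !mulr1.
Qed.

Lemma mxtrace_trace_ancillas a b eA eB rho :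
  \tr (@trace_ancillas R a b eA eB rho) = \tr rho.
Proof. by rewrite mxtrace_ptrace2 mxtrace_swap_middle. Qed.

Lemma extend_box_swap_middle a b eA eB X (s : 'M[C]_(a * b)) (t : 'M[C]_(eA.+1 * eB.+1)) :
  linear X ->
  @extend_box R a b eA eB X (swap_middle (s *t t)) = swap_middle (X s *t t).
Proof. by move=> lX; rewrite /extend_box swap_middleK tens_map_tens. Qed.

Lemma trace_ancillas_swap_middle a b eA eB (s : 'M[C]_(a * b)) (t : 'M[C]_(eA.+1 * eB.+1)) :
  @trace_ancillas R a b eA eB (swap_middle (s *t t)) = \tr t *: s.
Proof. by rewrite /trace_ancillas swap_middleK ptrace2_tens. Qed.

(** The isometry that adjoins an ancilla in the basis state [c]; its adjoint projects the ancilla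
    onto that state and discards it. *)
Definition ancilla_ket a e (c : 'I_e) : 'M[C]_(a * e, a) :=
  \matrix_(x, y) (x == mxtens_index (y, c))%:R.

Lemma krausmap_ancilla_ket a e (c : 'I_e) (s : 'M[C]_a) :
  krausmap (ancilla_ket a c) s = s *t delta_mx c c.
Proof.
apply/matrixP => x y; case: (mxtens_indexP x) => i k; case: (mxtens_indexP y) => j l.
rewrite tensmxE !mxE (bigD1 j)//= big1 ?addr0 => [|j' nj]; last first.
  by rewrite !mxE mxtens_index_eq xpair_eqE (eq_sym j) (negPf nj) /= conjC0 mulr0.
rewrite !mxE mxtens_index_eq xpair_eqE eqxx /= conjC_nat.
rewrite (bigD1 i)//= big1 ?addr0 => [|i' ni]; last first.
  by rewrite !mxE mxtens_index_eq xpair_eqE (eq_sym i) (negPf ni) /= mul0r.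
rewrite !mxE mxtens_index_eq xpair_eqE eqxx /= -mulrA mulrCA.
by rewrite -natrM mulnb.
Qed.

Lemma krausmap_ancilla_bra a e (c : 'I_e) (s : 'M[C]_a) (t : 'M[C]_e) :
  krausmap ((ancilla_ket a c) ^t*) (s *t t) = t c c *: s.
Proof.
apply/matrixP => i j; rewrite /krausmap trmxCK !mxE.
rewrite (bigD1 (mxtens_index (j, c)))//= big1 ?addr0 => [|y ny]; last first.
  by rewrite [X in _ * X]mxE (negPf ny) mulr0.
rewrite [X in _ * X]mxE eqxx mulr1 mxE.
rewrite (bigD1 (mxtens_index (i, c)))//= big1 ?addr0 => [|y ny]; last first.
  by rewrite !mxE (negPf ny) conjC0 mul0r.
by rewrite !mxE eqxx conjC1 mul1r !mxtens_indexK mulrC.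
Qed.

(** Together with the Kraus forms of the partial trace and of a local box, this lets the lower bound
    treat all that surrounds [F i] and [G i] as maps with product Kraus operators. *)
Lemma add_ancillas_kraus a b eA eB rho :
  @add_ancillas R a b eA eB rho =
  krausmap (ancilla_ket a (ord0 : 'I_eA.+1) *t ancilla_ket b (ord0 : 'I_eB.+1)) rho.
Proof.
move: rho; apply: eq_linear_tens; try exact: krausmap_linear.
  exact: add_ancillas_linear.
by move=> s t; rewrite krausmap_tens !krausmap_ancilla_ket /add_ancillas swap_middle_tens.
Qed.

Lemma trace_ancillas_kraus a b eA eB rho :
  @trace_ancillas R a b eA eB rho =
  \sum_(k : 'I_eA.+1 * 'I_eB.+1)
    krausmap ((ancilla_ket a k.1) ^t* *t (ancilla_ket b k.2) ^t*) rho.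
Proof.
move: rho; apply: eq_linear_tens4; first exact: trace_ancillas_linear.
  by apply: sum_linear => k; exact: krausmap_linear.
move=> s u t v; rewrite /trace_ancillas swap_middle_tens ptrace2_tens.
rewrite mxtrace_tens /mxtrace mulr_suml scaler_suml.
under eq_bigr do rewrite mulr_sumr scaler_suml.
rewrite pair_bigA; apply: eq_bigr => -[i j] _ /=.
by rewrite krausmap_tens !krausmap_ancilla_bra tensmxZl tensmxZr scalerA.
Qed.

Lemma extend_box_kraus a b eA eB (P : 'M[C]_a) (Q : 'M[C]_b) rho :
  @extend_box R a b eA eB (unitary_channel (P *t Q)) rho =
  krausmap ((P *t 1%:M) *t (Q *t 1%:M)) rho.
Proof.
move: rho; apply: eq_linear_tens4; first exact: extend_box_linear.
  exact: krausmap_linear.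
move=> s u t v; rewrite !krausmap_tens !krausmap1 -[in RHS]swap_middle_tens.
rewrite -(swap_middle_tens s u t v) extend_box_swap_middle; last exact: krausmap_linear.
by rewrite -krausmap_tens.
Qed.

End Ancillas.

(** * Signed separable maps *)

Section SeparableMaps.
Variable R : realType.
Local Notation C := R[i].

Definition product_kraus a b a' b' (s : seq ('M[C]_(a', a) * 'M[C]_(b', b))) :
    super R (a * b) (a' * b') :=
  fun rho => \sum_(k <- s) krausmap (k.1 *t k.2) rho.

Definition signed_product_kraus a b a' b'
    (s : seq (bool * ('M[C]_(a', a) * 'M[C]_(b', b)))) : super R (a * b) (a' * b') :=
  fun rho => \sum_(k <- s) (-1) ^+ k.1 *: krausmap (k.2.1 *t k.2.2) rho.

(** A relaxation of signed LOCC maps: a difference of two separable maps whose sum is trace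
    preserving. It has no rounds and is stable under composition. *)
Definition signed_separable a b a' b' (T : super R (a * b) (a' * b')) :=
  exists s, T =1 signed_product_kraus s /\ TP (product_kraus (unzip2 s)).

Lemma product_kraus_linear a b a' b' (s : seq ('M[C]_(a', a) * 'M[C]_(b', b))) :
  linear (product_kraus s).
Proof. by apply: sum_linear => k; exact: krausmap_linear. Qed.

Lemma product_kraus_signed_separable a b a' b' (T : super R (a * b) (a' * b'))
    (s : seq ('M[C]_(a', a) * 'M[C]_(b', b))) :
  T =1 product_kraus s -> TP T -> signed_separable T.
Proof.
move=> Ts tpT; exists [seq (false, k) | k <- s]; split=> rho.
  rewrite Ts /signed_product_kraus big_map; apply: eq_bigr => k _.
  by rewrite expr0 scale1r.
by rewrite /unzip2 -map_comp map_id -Ts.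
Qed.

(** Kraus operators multiply pairwise and signs add modulo 2, so forgetting the signs commutes with
    composition and trace preservation passes to the composite. *)
Lemma signed_separable_comp a b a1 b1 a2 b2
    (T : super R (a * b) (a1 * b1)) (T' : super R (a1 * b1) (a2 * b2)) :
  signed_separable T -> signed_separable T' -> signed_separable (T' \o T).
Proof.
move=> [s [Ts tps]] [s' [Ts' tps']].
exists [seq (k'.1 (+) k.1, (k'.2.1 *m k.2.1, k'.2.2 *m k.2.2)) | k' <- s', k <- s].
split=> rho.
  rewrite /= Ts' Ts /signed_product_kraus big_allpairs_dep; apply: eq_bigr => k' _.
  rewrite (linear_fun_sum (@krausmap_linear _ _ _ _)) scaler_sumr.
  apply: eq_bigr => k _; rewrite (linear_funZ (@krausmap_linear _ _ _ _)).
  by rewrite krausmap_comp tensmx_mul scalerA signr_addb.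
rewrite -(tps rho) -(tps' (product_kraus _ rho)) /product_kraus /unzip2.
rewrite !big_map big_allpairs_dep /=; congr (\tr _).
apply: eq_bigr => k' _; rewrite (linear_fun_sum (@krausmap_linear _ _ _ _)).
by apply: eq_bigr => k _; rewrite krausmap_comp tensmx_mul.
Qed.

Lemma tens_map_CP a b a' b' (f : super R a a') (g : super R b b') :
  CP f -> CP g -> exists s, tens_map f g =1 product_kraus s.
Proof.
move=> cf cg; have [s fs] := CP_kraus cf; have [t gt] := CP_kraus cg.
exists [seq (A, B) | A <- s, B <- t].
apply: eq_linear_tens; [by apply: tens_map_linear; case: cg|exact: product_kraus_linear|].
move=> x y; case: cf cg => lf _ [lg _]; rewrite tens_map_tens// fs gt.
rewrite /product_kraus big_allpairs_dep tensmx_suml; apply: eq_bigr => A _.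
by rewrite tensmx_sumr; apply: eq_bigr => B _; rewrite krausmap_tens.
Qed.

Lemma TP_tens a b n (f : super R (a * b) n) : linear f ->
  (forall s t, \tr (f (s *t t)) = \tr s * \tr t) -> TP f.
Proof.
move=> lf ft rho; rewrite [rho]mx_sum_block (linear_fun_sum lf) !raddf_sum.
apply: eq_bigr => i _; rewrite (linear_fun_sum lf) !raddf_sum.
by apply: eq_bigr => j _; rewrite /= ft mxtrace_tens.
Qed.

(** On a product input the trace preserving maps [T i] give the same factor for every outcome; what
    remains is the summed trace of the instrument of the other party. *)
Lemma one_way_TP a b a' b' (I : finType) (G : I -> super R (a * b) (a' * b')) :
  one_way_fromA G \/ one_way_fromB G -> TP (fun rho => \sum_i G i rho).
Proof.
have sumTP (E : I -> super R a a') (T : I -> super R b b') :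
    (forall i, CP (E i)) -> (forall i, CP (T i)) ->
    (forall i rho, G i rho = tens_map (E i) (T i) rho) ->
    (forall s t, \sum_i \tr (E i s) * \tr (T i t) = \tr s * \tr t) ->
    TP (fun rho => \sum_i G i rho).
  move=> cE cT GET tr_sum; apply: TP_tens.
    apply: sum_linear => i x y z; rewrite !GET; apply: tens_map_linear.
    by case: (cT i).
  move=> s t; rewrite -tr_sum raddf_sum; apply: eq_bigr => i _ /=.
  by rewrite GET tens_map_tens ?mxtrace_tens//; [case: (cE i)|case: (cT i)].
case=> [[E [T [[cE tpE] cT GET]]]|[T [E [cT [cE tpE] GET]]]].
  apply: (sumTP E T) => // [i|s t]; first by case: (cT i).
  under eq_bigr => i _ do rewrite (cT i).2.
  by rewrite -mulr_suml -raddf_sum /= tpE.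
apply: (sumTP T E) => // [i|s t]; first by case: (cT i).
under eq_bigr => i _ do rewrite (cT i).2.
by rewrite -mulr_sumr -raddf_sum /= tpE.
Qed.

Lemma one_way_product_kraus a b a' b' (I : finType)
    (G : I -> super R (a * b) (a' * b')) :
  one_way_fromA G \/ one_way_fromB G -> forall i, exists s, G i =1 product_kraus s.
Proof.
case=> [[E [T [[cE _] cT GET]]]|[T [E [cT [cE _] GET]]]] i.
  have [s st] := tens_map_CP (cE i) (cT i).1.
  by exists s => rho; rewrite GET st.
have [s st] := tens_map_CP (cT i).1 (cE i).
by exists s => rho; rewrite GET st.
Qed.

(** Communication only lets later local operators depend on earlier outcomes, which keeps every
    Kraus operator a product. A new round preserves the trace of each [E i rho] separately, hence
    that of their sum. *)
Lemma locc_rounds_product_kraus a b a' b' (I : finType)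
    (E : I -> super R (a * b) (a' * b')) :
  locc_rounds E ->
  (exists s, forall i, E i =1 product_kraus (s i)) /\ TP (fun rho => \sum_i E i rho).
Proof.
elim=> {a' b' I E} [|a1 b1 a2 b2 I E J G _ [[s Es] tpE] oneG].
  split; last by move=> rho; rewrite big_const card_unit /= addr0.
  exists (fun=> [:: (1%:M, 1%:M)]) => _ rho.
  by rewrite /product_kraus big_seq1 tensmx1 krausmap1.
split.
  have ex_s (p : {i & J i}) :
      exists t, G (tag p) (tagged p) \o E (tag p) =1 product_kraus t.
    case: p => i j /=.
    have [t Gt] := one_way_product_kraus (oneG i) j.
    exists [seq (k'.1 *m k.1, k'.2 *m k.2) | k' <- t, k <- s i] => rho /=.
    rewrite Gt Es /product_kraus big_allpairs_dep; apply: eq_bigr => k' _.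
    rewrite (linear_fun_sum (@krausmap_linear _ _ _ _)); apply: eq_bigr => k _.
    by rewrite krausmap_comp tensmx_mul.
  by have [t Et] := fin_all_exists ex_s; exists t.
move=> rho; rewrite -(tpE rho).
rewrite -(@sig_big_dep _ _ _ _ J xpredT (fun _ => xpredT) (fun i j => G i j (E i rho))) /=.
rewrite !raddf_sum; apply: eq_bigr => i _ /=.
exact: (one_way_TP (oneG i)).
Qed.

(** Coarse-graining sums outcomes that share one sign, so each fine outcome [i] can carry the sign
    of its class [f i]. *)
Lemma LOCC_signed_separable a b (F : super R (a * b) (a * b)) :
  LOCC F -> signed_separable F.
Proof.
move=> [K [G [sg [[I [E [f [rE GE]]]] FG]]]].
have [[s Es] tpE] := locc_rounds_product_kraus rE.
exists [seq (sg (f i), k) | i <- enum I, k <- s i]; split=> rho.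
  rewrite FG /signed_product_kraus big_allpairs_dep big_enum /=.
  rewrite (partition_big f xpredT) //=; apply: eq_bigr => k _.
  rewrite GE scaler_sumr; apply: eq_bigr => i /eqP <-.
  by rewrite Es scaler_sumr.
rewrite -(tpE rho); congr (\tr _); rewrite /product_kraus /unzip2 big_map big_allpairs_dep.
by rewrite big_enum; apply: eq_bigr => i _; rewrite Es.
Qed.

End SeparableMaps.

(** * Cauchy-Schwarz and Bessel inequalities *)

Section LowerBound.
Variable C : numClosedFieldType.

(** Lagrange's identity: twice the difference of the two sides is the double sum of the squares of
    [x k * y l - x l * y k]. *)
Lemma sum_mul_sqr_le (K : finType) (x y : K -> C) :
  (forall k, x k \is Num.real) -> (forall k, y k \is Num.real) ->
  (\sum_k x k * y k) ^+ 2 <= (\sum_k x k ^+ 2) * (\sum_k y k ^+ 2).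
Proof.
move=> rx ry; rewrite -subr_ge0 -(pmulr_rge0 _ (ltr0n C 2)) mulrBr.
have -> : 2 * ((\sum_k x k ^+ 2) * (\sum_k y k ^+ 2)) =
    \sum_k \sum_l (x k ^+ 2 * y l ^+ 2 + x l ^+ 2 * y k ^+ 2).
  rewrite mulr_natl mulr2n {2}mulrC !mulr_suml -big_split; apply: eq_bigr => k _.
  rewrite /= !mulr_sumr -big_split; apply: eq_bigr => l _ /=.
  by congr (_ + _); rewrite mulrC.
rewrite expr2 mulr_suml mulr_sumr -sumrB; apply: sumr_ge0 => k _.
rewrite !mulr_sumr -sumrB; apply: sumr_ge0 => l _.
rewrite [X in 0 <= X](_ : _ = (x k * y l - x l * y k) ^+ 2); last by ring.
by rewrite real_exprn_even_ge0// rpredB// rpredM.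
Qed.

(** Each [V k] has squared Hilbert-Schmidt norm n, so the projection of [A] onto their span has
    coefficients [c k / n]. The bound is n times the nonnegative squared distance from [A] to that
    projection. *)
Lemma bessel_mxtrace n (K : finType) (V : K -> 'M[C]_n) (A : 'M[C]_n) :
  (0 < n)%N ->
  (forall k l, \tr ((V k) ^t* *m V l) = n%:R * (k == l)%:R) ->
  \sum_k `|\tr ((V k) ^t* *m A)| ^+ 2 <= n%:R * \tr (A ^t* *m A).
Proof.
move=> n0 orthoV; have [c cE] : exists c, forall k, c k = \tr ((V k) ^t* *m A) by eexists.
under eq_bigr do rewrite -cE.
have pos (B : 'M[C]_n) : 0 <= \tr (B ^t* *m B).
  apply: sumr_ge0 => i _; rewrite mxE; apply: sumr_ge0 => j _.
  by rewrite !mxE mulrC mul_conjC_ge0.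
have nC : n%:R != 0 :> C by rewrite pnatr_eq0 -lt0n.
have tr_adj (B D : 'M[C]_n) : \tr (B ^t* *m D) = (\tr (D ^t* *m B))^*.
  rewrite -[B in RHS]trmxCK -adjmx_mul /mxtrace rmorph_sum.
  by apply: eq_bigr => i _; rewrite [in RHS]mxE [in RHS]mxE /= conjCK.
have := pos (A + (- n%:R^-1) *: \sum_k c k *: V k).
rewrite -(pmulr_rge0 _ (_ : 0 < n%:R :> C)) ?ltr0n//.
set S := \sum_k _.
have SA : \tr (S ^t* *m A) = \sum_k `|c k| ^+ 2.
  rewrite adjmx_sum mulmx_suml raddf_sum; apply: eq_bigr => k _ /=.
  by rewrite adjmxZ -scalemxAl mxtraceZ normCK -cE mulrC.
have SS : \tr (S ^t* *m S) = n%:R * \sum_k `|c k| ^+ 2.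
  rewrite {1}/S adjmx_sum mulmx_suml raddf_sum mulr_sumr; apply: eq_bigr => k _ /=.
  rewrite adjmxZ -scalemxAl mxtraceZ mulmx_sumr raddf_sum (bigD1 k)//=.
  rewrite big1 ?addr0 => [|l /negPf lk]; last first.
        by rewrite -scalemxAr mxtraceZ orthoV eq_sym lk !mulr0.
  by rewrite -scalemxAr mxtraceZ orthoV eqxx mulr1 normCK; ring.
have AS : \tr (A ^t* *m S) = \sum_k `|c k| ^+ 2.
  by rewrite tr_adj SA; apply/CrealP/rpred_sum => k _; rewrite rpredX// normr_real.
rewrite adjmxD adjmxZ rmorphN fmorphV /= conjC_nat.
rewrite mulmxDl !mulmxDr -!scalemxAl -!scalemxAr !mxtraceD !mxtraceZ SA SS AS.
move=> H; rewrite -subr_ge0; apply: le_trans H _; rewrite le_eqVlt; apply/orP; left.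
by apply/eqP; field.
Qed.

End LowerBound.

(** * Overlap with a maximally entangled operator *)

Section OrthogonalOperators.
Variable C : numClosedFieldType.

Lemma polar_phase (z : C) : exists p, `|p| = 1 /\ z = `|z| * p.
Proof.
(* Zero has no phase of its own, but the overlap bound wants unit modulus for every index. *)
have [->|z0] := eqVneq z 0; first by exists 1; rewrite normr1 normr0 mul0r.
have nz : `|z| != 0 by rewrite normr_eq0.
exists (z / `|z|); rewrite normf_div normr_id divff//.
by split=> //; rewrite mulrCA divff ?mulr1.
Qed.

Lemma mxtrace_orthogonal_comb n (K : finType) (V : K -> 'M[C]_n) (N : C) (x y : K -> C) :
  (forall k l, \tr ((V k) ^t* *m V l) = N * (k == l)%:R) ->
  \tr ((\sum_k x k *: V k) ^t* *m (\sum_k y k *: V k)) = N * \sum_k (x k)^* * y k.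
Proof.
move=> orthoV; rewrite adjmx_sum mulmx_suml raddf_sum mulr_sumr.
apply: eq_bigr => k _; rewrite /= mulmx_sumr raddf_sum (bigD1 k)//=.
rewrite big1 ?addr0 => [|l /negPf lk]; last first.
  by rewrite adjmxZ -scalemxAl -scalemxAr !mxtraceZ orthoV eq_sym lk !mulr0.
rewrite adjmxZ -scalemxAl -scalemxAr !mxtraceZ orthoV eqxx mulr1.
by rewrite mulrA mulrC.
Qed.

Lemma tens_orthogonal a b (K : finType) (VA : K -> 'M[C]_a) (VB : K -> 'M[C]_b) :
  (forall k l, \tr ((VA k) ^t* *m VA l) = a%:R * (k == l)%:R) ->
  (forall k l, \tr ((VB k) ^t* *m VB l) = b%:R * (k == l)%:R) ->
  forall k l, \tr ((VA k *t VB k) ^t* *m (VA l *t VB l)) = (a * b)%:R * (k == l)%:R.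
Proof.
move=> oA oB k l; rewrite adjmx_tens tensmx_mul mxtrace_tens oA oB mulrACA natrM.
by case: (k == l); rewrite !(mulr0, mulr1).
Qed.

(* A product operator overlaps with the maximally entangled operator
   \sum_k p k *: (VA k *t VB k) no more than its own norm does: Cauchy-Schwarz
   over k followed by Bessel's inequality on each side. *)
Lemma product_overlap a b (K : finType) (VA : K -> 'M[C]_a) (VB : K -> 'M[C]_b)
    (p : K -> C) (A : 'M[C]_a) (B : 'M[C]_b) :
  (0 < a)%N -> (0 < b)%N -> (forall k, `|p k| = 1) ->
  (forall k l, \tr ((VA k) ^t* *m VA l) = a%:R * (k == l)%:R) ->
  (forall k l, \tr ((VB k) ^t* *m VB l) = b%:R * (k == l)%:R) ->
  `|\tr ((\sum_k p k *: (VA k *t VB k)) ^t* *m (A *t B))| ^+ 2 <=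
  (a * b)%:R * \tr ((A *t B) ^t* *m (A *t B)).
Proof.
move=> a0 b0 p1 oA oB; rewrite adjmx_sum mulmx_suml raddf_sum /=.
apply: (@le_trans _ _ ((\sum_k `|\tr ((VA k) ^t* *m A)| * `|\tr ((VB k) ^t* *m B)|) ^+ 2)).
  rewrite lerXn2r ?nnegrE ?normr_ge0//.
    by apply: sumr_ge0 => k _; rewrite mulr_ge0.
  apply: le_trans (ler_norm_sum _ _ _) _; apply: ler_sum => k _.
  rewrite adjmxZ -scalemxAl mxtraceZ adjmx_tens tensmx_mul mxtrace_tens !normrM.
  by rewrite norm_conjC p1 mul1r.
apply: le_trans (sum_mul_sqr_le _ _) _ => [k|k|]; rewrite ?normr_real//.
rewrite adjmx_tens tensmx_mul mxtrace_tens natrM mulrACA.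
apply: ler_pM; rewrite ?bessel_mxtrace//; apply: sumr_ge0 => k _;
  by rewrite exprn_ge0.
Qed.

(** With [x] the signed coefficient [q * (-1) ^+ s], the right side is [N * g] times the positive
    part of [x]. Negative terms are thus dropped and positive ones bounded through [f <= N * g]. *)
Lemma signed_term_le (q f g N : C) (s : bool) : q \is Num.real ->
  0 <= f -> f <= N * g ->
  q * ((-1) ^+ s * f) <= N / 2 * (`|q| * g + q * ((-1) ^+ s * g)).
Proof.
move=> qr f0 fg; rewrite !mulrA -signr_odd.
suff {q qr} H (x : C) : x \is Num.real -> x * f <= N / 2 * (`|x| * g + x * g).
  have /H : q * (-1) ^+ odd s \is Num.real by rewrite rpredM// rpredX// rpredN rpred1.
  by rewrite normrM normrX normrN1 expr1n mulr1.
have Ng0 := le_trans f0 fg.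
case/real_ge0P=> x0.
  rewrite -mulrDr -mulr2n -[g *+ 2]mulr_natr.
  rewrite (_ : N / 2 * _ = x * (N * g)) ?ler_wpM2l//; by field.
by rewrite mulNr addNr mulr0 nmulr_rle0.
Qed.

(** [(c + 1) / 2] is the positive weight of a decomposition with absolute weight [c] and signed
    weight 1. *)
Lemma cost_cancel (N x c : C) :
  0 < N -> N ^+ 2 * x <= N / 2 * (c * N + N) -> 2 * x - 1 <= c.
Proof.
move=> N0; rewrite (_ : N / 2 * _ = N ^+ 2 * ((c + 1) / 2)); last by field.
by rewrite ler_pM2l ?exprn_gt0// ler_pdivlMr// mulrC lerBlDr.
Qed.

End OrthogonalOperators.

(** * Cost bound from the fidelity of Choi states *)

Section Robustness.
Variable R : realType.
Local Notation C := R[i].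

(* On a map with Kraus operators M k this is \sum_k |\tr (Phi^t* *m M k)|^2, the
   unnormalised fidelity of the Choi state with the vectorisation of Phi. *)
Definition choi_form m n (Phi : 'M[C]_(n, m)) (T : super R m n) : C :=
  \sum_j \sum_l (Phi ^t* *m T (delta_mx j l) *m Phi) j l.

Lemma choi_form_krausmap m n (Phi M : 'M[C]_(n, m)) :
  choi_form Phi (krausmap M) = `|\tr (Phi ^t* *m M)| ^+ 2.
Proof.
rewrite normCK /choi_form {1}/mxtrace mulr_suml; apply: eq_bigr => j _.
rewrite /mxtrace rmorph_sum mulr_sumr; apply: eq_bigr => l _.
(* Writing the matrix unit as column times row makes the entry at [j], [l] the product of the [j]-th
   diagonal entry of [Phi ^t* *m M] and the conjugate of the [l]-th, so the double sum is a squared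
   modulus. *)
rewrite /krausmap -(mul_delta_mx (0 : 'I_1)) !mulmxA -colE.
rewrite -mulmxA (_ : M ^t* *m Phi = (Phi ^t* *m M) ^t*); last by rewrite adjmx_mul trmxCK.
rewrite -mulmxA -rowE mxE big_ord1 mxE [X in _ * X]mxE; congr (_ * _).
by rewrite [LHS]mxE; congr (_^*); rewrite mxE.
Qed.

Lemma choi_form_comb m n (Phi : 'M[C]_(n, m)) (I : Type) (s : seq I) (c : I -> C)
    (T : I -> super R m n) (F : super R m n) :
  (forall rho, F rho = \sum_(i <- s) c i *: T i rho) ->
  choi_form Phi F = \sum_(i <- s) c i * choi_form Phi (T i).
Proof.
move=> FT; rewrite /choi_form; under [RHS]eq_bigr do rewrite mulr_sumr.
rewrite [RHS]exchange_big; apply: eq_bigr => j _.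
under [RHS]eq_bigr do rewrite mulr_sumr.
rewrite [RHS]exchange_big; apply: eq_bigr => l _.
rewrite FT mulmx_sumr mulmx_suml summxE; apply: eq_bigr => i _.
by rewrite -scalemxAr -scalemxAl mxE.
Qed.

(* The signed Kraus operators of each T i have total weight a * b, while those of
   the product gate overlap with Phi by (a * b * \sum_k |w k|)^2; product_overlap
   then forces the positive weight to be at least (\sum_k |w k|)^2. *)
Lemma signed_separable_cost a b (K : finType) (VA : K -> 'M[C]_a) (VB : K -> 'M[C]_b)
    (w : K -> C) (I : finType) (q : I -> R) (T : I -> super R (a * b) (a * b)) :
  (0 < a)%N -> (0 < b)%N ->
  (forall k l, \tr ((VA k) ^t* *m VA l) = a%:R * (k == l)%:R) ->
  (forall k l, \tr ((VB k) ^t* *m VB l) = b%:R * (k == l)%:R) ->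
  \sum_k `|w k| ^+ 2 = 1 ->
  (forall i, signed_separable (T i)) ->
  (forall rho, krausmap (\sum_k w k *: (VA k *t VB k)) rho =
    \sum_i (q i)%:C%C *: T i rho) ->
  2 * (\sum_k `|w k|) ^+ 2 - 1 <= \sum_i `|(q i)%:C%C|.
Proof.
move=> a0 b0 oA oB w1 sepT WT.
have [p pE] := fin_all_exists (fun k => polar_phase (w k)).
(* [Phi] carries the phases of [w], so its overlap with the gate adds the moduli [|w k|] without
   cancellation. *)
pose Phi := \sum_k p k *: (VA k *t VB k); pose N : C := (a * b)%:R.
have N0 : 0 < N by rewrite ltr0n muln_gt0 a0.
have oV := tens_orthogonal oA oB.
have formW : choi_form Phi (krausmap (\sum_k w k *: (VA k *t VB k))) =
    N ^+ 2 * (\sum_k `|w k|) ^+ 2.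
  rewrite choi_form_krausmap (mxtrace_orthogonal_comb _ _ oV) normrM exprMn.
  rewrite ger0_norm ?ltW//; congr (_ * _); rewrite -[RHS]ger0_norm ?sumr_ge0//; last first.
    by rewrite exprn_ge0// sumr_ge0.
  rewrite normrX; congr (`|_| ^+ 2); apply: eq_bigr => k _.
  have [p1 {1}->] := pE k.
  by rewrite mulrCA [_^* * _]mulrC -normCK p1 expr1n mulr1.
have traceW : \tr (krausmap (\sum_k w k *: (VA k *t VB k)) 1%:M) = N.
  rewrite mxtrace_krausmap mulmx1 (mxtrace_orthogonal_comb _ _ oV).
  rewrite (eq_bigr (fun k => `|w k| ^+ 2)) ?w1 ?mulr1// => k _.
  by rewrite normCK mulrC.
have bound i : (q i)%:C%C * choi_form Phi (T i) <=
    N / 2 * (`|(q i)%:C%C| * N + (q i)%:C%C * \tr (T i 1%:M)).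
  have [s [Ts tps]] := sepT i.
  pose M (k : bool * ('M[C]_a * 'M[C]_b)) := k.2.1 *t k.2.2.
  rewrite (choi_form_comb _ (s := s) (c := fun k => (-1) ^+ k.1)
    (T := fun k => krausmap (M k)) Ts).
  have NE : N = \sum_(k <- s) \tr ((M k) ^t* *m M k).
    have := tps 1%:M; rewrite mxtrace1 -/N => <-.
    rewrite /product_kraus big_map raddf_sum; apply: eq_bigr => k _ /=.
    by rewrite mxtrace_krausmap mulmx1.
  have TE : \tr (T i 1%:M) = \sum_(k <- s) (-1) ^+ k.1 * \tr ((M k) ^t* *m M k).
    rewrite Ts raddf_sum; apply: eq_bigr => k _ /=.
    by rewrite mxtraceZ mxtrace_krausmap mulmx1.
  rewrite TE {2}NE !mulr_sumr -big_split /= mulr_sumr; apply: ler_sum => k _.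
  apply: signed_term_le; first by apply/complex_realP; exists (q i).
    by rewrite choi_form_krausmap exprn_ge0.
  rewrite choi_form_krausmap; apply: product_overlap => // k'.
  by have [] := pE k'.
have : N ^+ 2 * (\sum_k `|w k|) ^+ 2 <=
    \sum_i N / 2 * (`|(q i)%:C%C| * N + (q i)%:C%C * \tr (T i 1%:M)).
  rewrite -formW (choi_form_comb _ (s := index_enum I) (c := fun i => (q i)%:C%C) WT).
  by apply: ler_sum => i _; exact: bound.
rewrite -mulr_sumr big_split /=.
(* The signed weights add up to the weight of the gate itself, which is [N] because [w] is
   normalised. *)
have -> : \sum_i (q i)%:C%C * \tr (T i 1%:M) = N.
  rewrite -traceW WT raddf_sum; apply: eq_bigr => i _ /=.
  by rewrite mxtraceZ.
by rewrite -mulr_suml; exact: cost_cancel.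
Qed.

End Robustness.

(** * Local decomposition with ancilla qubits *)

Section AncillaGates.
Variable R : realType.
Local Notation C := R[i].

Lemma psdD n (x y : 'M[C]_n) : psd x -> psd y -> psd (x + y).
Proof. by move=> px py v; rewrite mulmxDr mulmxDl mxE addr_ge0. Qed.

Lemma CP_add m n (f g : super R m n) : CP f -> CP g -> CP (fun rho => f rho + g rho).
Proof.
move=> [lf pf] [lg pg]; split=> [a x y|k rho rho_psd].
  by rewrite lf lg scalerDr addrACA.
rewrite (_ : tens_map _ _ _ = tens_map id f rho + tens_map id g rho).
  by apply: psdD; [exact: pf|exact: pg].
rewrite /tens_map -big_split; apply: eq_bigr => i _; rewrite -big_split.
by apply: eq_bigr => j _; rewrite tensmxDr.
Qed.

Lemma kraus_pair_calN n (A B : 'M[C]_n) :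
  A ^t* *m A + B ^t* *m B = 1%:M ->
  calN (fun rho => krausmap A rho - krausmap B rho).
Proof.
move=> AB1; exists (krausmap A), (krausmap B); split; try exact: krausmap_CP; last by [].
split; first by apply: CP_add; exact: krausmap_CP.
by move=> rho; rewrite mxtraceD !mxtrace_krausmap -mxtraceD -mulmxDl AB1 mul1mx.
Qed.

Lemma unitary_LO a b (A : 'M[C]_a) (B : 'M[C]_b) :
  A \is unitarymx -> B \is unitarymx -> LO (krausmap (A *t B)).
Proof.
have calN_unitary n (U : 'M[C]_n) : U \is unitarymx -> calN (krausmap U).
  move=> uU; have := @kraus_pair_calN _ U 0.
  rewrite unitarymx_adjl// mulmx0 addr0 => /(_ erefl) [Ap [Am [cp cm cpm E]]].
  exists Ap, Am; split=> // rho; rewrite -E /krausmap !mul0mx.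
  by rewrite subr0.
move=> uA uB; exists (krausmap A), (krausmap B); split; try exact: calN_unitary.
by move=> rho; rewrite tens_map_krausmap.
Qed.

(** With [D c] the projection on the basis state [c] this is the usual controlled gate. A general
    [D] also covers a preparation before the control and a measurement after it. *)
Definition controlled a (f : 'I_2 -> 'M[C]_a) (D : 'I_2 -> 'M[C]_2) : 'M[C]_(a * 2) :=
  \sum_c f c *t D c.

Lemma controlled_mull a (f : 'I_2 -> 'M[C]_a) (D : 'I_2 -> 'M[C]_2) P :
  (1%:M *t P) *m controlled f D = controlled f (fun c => P *m D c).
Proof.
by rewrite /controlled mulmx_sumr; apply: eq_bigr => c _; rewrite tensmx_mul mul1mx.
Qed.

Lemma controlled_mulr a (f : 'I_2 -> 'M[C]_a) (D : 'I_2 -> 'M[C]_2) P :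
  controlled f D *m (1%:M *t P) = controlled f (fun c => D c *m P).
Proof.
by rewrite /controlled mulmx_suml; apply: eq_bigr => c _; rewrite tensmx_mul mulmx1.
Qed.

Lemma controlled_adjl a (f : 'I_2 -> 'M[C]_a) :
  (forall c, f c \is unitarymx) ->
  (controlled f (fun c => delta_mx c c)) ^t* *m controlled f (fun c => delta_mx c c) = 1%:M.
Proof.
move=> uf; rewrite /controlled adjmx_sum mulmx_suml.
transitivity (\sum_(c < 2) (1%:M : 'M[C]_a) *t delta_mx c c).
  apply: eq_bigr => c _; rewrite mulmx_sumr (bigD1 c)//= big1 ?addr0 => [|d /negPf dc].
    rewrite adjmx_tens tensmx_mul (unitarymx_adjl (uf c)) trmx_delta map_delta_mx.
    by rewrite mul_delta_mx.
  rewrite adjmx_tens tensmx_mul trmx_delta map_delta_mx mul_delta_mx_0 ?tensmx0//.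
  by rewrite eq_sym dc.
rewrite -tensmx_sumr -tensmx1; congr (_ *t _); apply/matrixP => i j.
rewrite summxE (bigD1 i)//= big1 ?addr0 => [|c /negPf ci].
  by rewrite !mxE eqxx eq_sym.
by rewrite mxE eq_sym ci.
Qed.

(** [p] lists the branches on the left of the state and [r] those on its right; the first component
    belongs to A, the second to B. *)
Lemma krausmap_controlled a b (f D' : 'I_2 -> _) (D : 'I_2 -> 'M[C]_2) (g : 'I_2 -> 'M[C]_b)
    (Y : 'M[C]_(a * b)) (s t : 'M[C]_2) :
  krausmap (controlled f D *t controlled g D') (swap_middle (Y *t (s *t t))) =
  swap_middle (\sum_(p : 'I_2 * 'I_2) \sum_(r : 'I_2 * 'I_2)
    (f p.1 *t g p.2) *m Y *m (f r.1 *t g r.2) ^t*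
    *t ((D p.1 *m s *m (D r.1) ^t*) *t (D' p.2 *m t *m (D' r.2) ^t*))).
Proof.
have -> : controlled f D *t controlled g D' =
    swap_middle (\sum_(p : 'I_2 * 'I_2) (f p.1 *t g p.2) *t (D p.1 *t D' p.2)).
  rewrite (linear_fun_sum (@swap_middle_linear _ _ _ _ _)) /controlled tensmx_suml.
  under eq_bigr do rewrite tensmx_sumr.
  by rewrite pair_bigA; apply: eq_bigr => p _; rewrite swap_middle_tens.
rewrite krausmap_swap_middle; congr swap_middle; rewrite /krausmap adjmx_sum.
rewrite mulmx_suml mulmx_suml; apply: eq_bigr => p _; rewrite mulmx_sumr.
by apply: eq_bigr => r _; rewrite [X in _ *m X]adjmx_tens (adjmx_tens (D r.1)) !tensmx_mul.
Qed.

Definition hadamard : 'M[C]_2 :=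
  (sqrtC 2)^-1 *: \matrix_(i, j) (-1) ^+ ((i == 1) && (j == 1)).

Lemma hadamard_coef : (sqrtC 2)^-1 * ((sqrtC 2)^-1)^* = 2^-1 :> C.
Proof.
rewrite (CrealP _) ?realV ?ger0_real ?sqrtC_ge0//.
by rewrite -invfM -expr2 sqrtCK.
Qed.

Lemma hadamard_unitary : hadamard \is unitarymx.
Proof.
apply/unitarymxP; rewrite adjmxZ -scalemxAl -scalemxAr scalerA hadamard_coef.
apply/matrixP => i j; rewrite !mxE !big_ord_recl big_ord0 !mxE addr0 /=.
have h2 : 2^-1 * 2 = 1 :> C by rewrite mulVf ?pnatr_eq0.
case: i => [[|[|//]] ?]; case: j => [[|[|//]] ?];
  rewrite !(expr0, expr1, rmorphN, rmorph1, mulr1, mul1r, mulrN, mulrNN) /=;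
  rewrite ?subrr ?mulr0 ?mulr1n //.
by rewrite opprK.
Qed.

(** The uniform superposition gives every pair of branches, coherences included, the weight 1/2. *)
Lemma hadamard_outer (c d : 'I_2) :
  delta_mx c c *m hadamard *m delta_mx 0 0 *m (delta_mx d d *m hadamard) ^t* =
  2^-1 *: delta_mx c d.
Proof.
have H e : delta_mx e e *m hadamard *m delta_mx 0 (0 : 'I_1) = (sqrtC 2)^-1 *: delta_mx e 0.
  rewrite -mulmxA -colE; apply/matrixP => i j.
  rewrite !mxE (bigD1 e)//= big1 ?addr0; last first.
    by move=> k /negPf ke; rewrite mxE ke andbF mul0r.
  by rewrite !mxE eqxx andbF expr0 mulr1 mulrC (ord1 j) eqxx.
rewrite -[delta_mx 0 0](mul_delta_mx (0 : 'I_1)) !mulmxA H -mulmxA.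
rewrite -[X in _ *m X]trmxCK adjmx_mul trmxCK trmx_delta map_delta_mx H adjmxZ.
rewrite trmx_delta map_delta_mx -scalemxAl -scalemxAr scalerA hadamard_coef.
by rewrite mul_delta_mx.
Qed.

Lemma half_double (V : lmodType C) (x : V) : 2^-1 *: (x + x) = x.
Proof.
have -> : x + x = 2 *: x by rewrite scaler_nat mulr2n.
by rewrite scalerA mulVf ?scale1r// pnatr_eq0.
Qed.

(** For a Hermitian involution [M], the spectral projection for the eigenvalue [(-1) ^+ s];
    measuring with the two of them and recording the sign measures the observable [M]. *)
Definition half_proj (M : 'M[C]_2) (s : bool) : 'M[C]_2 := 2^-1 *: (1%:M + (-1) ^+ s *: M).

Lemma complete_comp n (W P Q : 'M[C]_n) :
  P ^t* *m P + Q ^t* *m Q = 1%:M -> W ^t* *m W = 1%:M ->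
  (P *m W) ^t* *m (P *m W) + (Q *m W) ^t* *m (Q *m W) = 1%:M.
Proof.
move=> PQ WW; rewrite !adjmx_mul !mulmxA.
rewrite -[X in X *m _ + _]mulmxA -[X in _ + X *m _]mulmxA -mulmxDl -mulmxDr.
by rewrite PQ mulmx1.
Qed.

Lemma half_proj_sqr (M : 'M[C]_2) s : M ^t* = M -> M *m M = 1%:M ->
  (half_proj M s) ^t* *m half_proj M s = half_proj M s.
Proof.
move=> Mh MM; have c2 : (2^-1)^* = 2^-1 :> C by rewrite fmorphV /= conjC_nat.
rewrite /half_proj adjmxZ adjmxD adjmx1 adjmxZ Mh c2.
rewrite rmorph_sign -scalemxAl -scalemxAr mulmxDl !mulmxDr !mul1mx !mulmx1.
rewrite -scalemxAl -scalemxAr MM !scalerA -signr_addb addbb expr0 scale1r.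
by rewrite [X in _ *: (_ + X)]addrC -scalerA half_double.
Qed.

Lemma half_projD (M : 'M[C]_2) : half_proj M false + half_proj M true = 1%:M.
Proof.
rewrite /half_proj expr0 expr1 scale1r scaleN1r -scalerDr addrACA subrr addr0.
by rewrite half_double.
Qed.

Lemma half_projB (M : 'M[C]_2) : half_proj M false - half_proj M true = M.
Proof.
rewrite /half_proj expr0 expr1 scale1r scaleN1r -scalerBr opprB addrC addrA subrK.
by rewrite half_double.
Qed.

Definition readout_op a (f : 'I_2 -> 'M[C]_a) (P : 'M[C]_2) : 'M[C]_(a * 2) :=
  controlled f (fun c => P *m delta_mx c c).

(* Measures the ancilla with the operators P and Q after the f c controlled on it,
   and multiplies by -1 on the second outcome. *)
Definition readout a (f : 'I_2 -> 'M[C]_a) (P Q : 'M[C]_2) : super R (a * 2) (a * 2) :=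
  fun rho =>
    krausmap (readout_op f P) rho - krausmap (readout_op f Q) rho.

Lemma readout_calN a (f : 'I_2 -> 'M[C]_a) (P Q : 'M[C]_2) :
  (forall c, f c \is unitarymx) -> P ^t* *m P + Q ^t* *m Q = 1%:M ->
  calN (readout f P Q).
Proof.
move=> uf PQ; apply: kraus_pair_calN.
have E S : readout_op f S =
    (1%:M *t S) *m controlled f (fun c => delta_mx c c).
  by rewrite /readout_op controlled_mull.
rewrite (E P) (E Q) complete_comp ?controlled_adjl//.
by rewrite !adjmx_tens !tensmx_mul -tensmxDr PQ adjmx1 mulmx1 tensmx1.
Qed.

Lemma mxtrace_sandwich (P : 'M[C]_2) (c d e h : 'I_2) :
  \tr ((P *m delta_mx c c) *m delta_mx e h *m (P *m delta_mx d d) ^t*) =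
  ((c == e)%:R * (d == h)%:R) * (P ^t* *m P) h e.
Proof.
have mid : delta_mx c c *m delta_mx e h *m delta_mx d d =
    ((c == e)%:R * (d == h)%:R) *: delta_mx e h :> 'M[C]_2.
  have [<-|ce] := eqVneq c e; last by rewrite mul_delta_mx_0// mul0mx mul0r scale0r.
  rewrite mul_delta_mx mul1r; have [->|dh] := eqVneq d h.
    by rewrite mul_delta_mx scale1r.
  by rewrite mul_delta_mx_0 1?eq_sym// scale0r.
rewrite adjmx_mul trmx_delta map_delta_mx !mulmxA mxtrace_mulC !mulmxA.
rewrite -!mulmxA (mulmxA (delta_mx c c)) mid -!scalemxAr mxtraceZ; congr (_ * _).
rewrite mulmxA -(mul_delta_mx (0 : 'I_1)) mulmxA mxtrace_mulC -colE -rowE.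
by rewrite /mxtrace big_ord1 mxE mxE.
Qed.

Lemma tens_mapBB m n p q (f f' : super R m n) (g g' : super R p q) rho :
  tens_map (fun x => f x - f' x) (fun x => g x - g' x) rho =
  tens_map f g rho - tens_map f g' rho - tens_map f' g rho + tens_map f' g' rho.
Proof.
rewrite /tens_map -!sumrB -big_split; apply: eq_bigr => i _ /=.
rewrite -!sumrB -big_split; apply: eq_bigr => j _ /=.
by rewrite tensmxBl !tensmxBr opprD opprK addrA.
Qed.

Lemma sum_delta_pair (V : lmodType C) (I J : finType) (c c' : I) (d d' : J) (x y : C)
    (F : I * J -> I * J -> V) :
  \sum_p \sum_r ((p.1 == c)%:R * (r.1 == c')%:R * x *
                 ((p.2 == d)%:R * (r.2 == d')%:R * y)) *: F p r =
  (x * y) *: F (c, d) (c', d').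
Proof.
rewrite (bigD1 (c, d)) //= addrC big1 ?add0r => [|[e e'] nce]; last first.
  rewrite big1// => r _; move: nce; rewrite xpair_eqE negb_and => /orP[] /negPf /= ->.
    by rewrite !mul0r scale0r.
  by rewrite !mul0r mulr0 scale0r.
rewrite (bigD1 (c', d')) //= addrC big1 ?add0r => [|[e e'] nce]; last first.
  move: nce; rewrite xpair_eqE negb_and => /orP[] /negPf /= ->.
    by rewrite mulr0 !mul0r scale0r.
  by rewrite mulr0 mul0r mulr0 scale0r.
by rewrite /= !eqxx !mul1r.
Qed.

Lemma trace_krausmap_controlled a b (f D' : 'I_2 -> _) (D : 'I_2 -> 'M[C]_2)
    (g : 'I_2 -> 'M[C]_b) (Y : 'M[C]_(a * b)) (s t : 'M[C]_2) :
  @trace_ancillas R a b 1 1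
    (krausmap (controlled f D *t controlled g D') (swap_middle (Y *t (s *t t)))) =
  \sum_(p : 'I_2 * 'I_2) \sum_(r : 'I_2 * 'I_2)
    (\tr (D p.1 *m s *m (D r.1) ^t*) * \tr (D' p.2 *m t *m (D' r.2) ^t*)) *:
    ((f p.1 *t g p.2) *m Y *m (f r.1 *t g r.2) ^t*).
Proof.
rewrite krausmap_controlled.
have lin := @trace_ancillas_linear R a b 1 1.
rewrite (linear_fun_sum (@swap_middle_linear R a 2 b 2)) (linear_fun_sum lin).
apply: eq_bigr => p _.
rewrite (linear_fun_sum (@swap_middle_linear R a 2 b 2)) (linear_fun_sum lin).
apply: eq_bigr => r _.
by rewrite trace_ancillas_swap_middle mxtrace_tens.
Qed.

(** The controls match the ancilla coherences with one choice of branches on each side of [Y]; the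
    trace weighs it by the corresponding entries of the effects of the two measurements. *)
Lemma krausmap_readout_trace a b (f : 'I_2 -> 'M[C]_a) (g : 'I_2 -> 'M[C]_b)
    (P P' : 'M[C]_2) (Y : 'M[C]_(a * b)) (c c' d d' : 'I_2) :
  @trace_ancillas R a b 1 1
    (krausmap (readout_op f P *t readout_op g P')
      (swap_middle (Y *t (delta_mx c c' *t delta_mx d d')))) =
  ((P ^t* *m P) c' c * (P' ^t* *m P') d' d) *:
    ((f c *t g d) *m Y *m (f c' *t g d') ^t*).
Proof.
rewrite trace_krausmap_controlled.
under eq_bigr do under eq_bigr do rewrite !mxtrace_sandwich.
exact: (sum_delta_pair _ _ _ _ _ _
  (fun p r => (f p.1 *t g p.2) *m Y *m (f r.1 *t g r.2) ^t*)).
Qed.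

Lemma tens_map_readout a b (f : 'I_2 -> 'M[C]_a) (g : 'I_2 -> 'M[C]_b)
    (P Q P' Q' : 'M[C]_2) rho :
  tens_map (readout f P Q) (readout g P' Q') rho =
  krausmap (readout_op f P *t readout_op g P') rho -
  krausmap (readout_op f P *t readout_op g Q') rho -
  krausmap (readout_op f Q *t readout_op g P') rho +
  krausmap (readout_op f Q *t readout_op g Q') rho.
Proof.
etransitivity; first exact: tens_mapBB.
by congr (_ - _ - _ + _); exact: tens_map_krausmap.
Qed.

Lemma trace_ancillas_alternating a b x y z t :
  @trace_ancillas R a b 1 1 (x - y - z + t) =
  trace_ancillas x - trace_ancillas y - trace_ancillas z + trace_ancillas t.
Proof.
have lin := @trace_ancillas_linear R a b 1 1.
rewrite -[- y]scaleN1r -[- z]scaleN1r !(linear_funD lin) !(linear_funZ lin).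
by rewrite !scaleN1r.
Qed.

(** The four signed outcomes factor into a difference of effects for each party. Off-diagonal
    entries of the observables [M] and [N] thereby extract terms with different operators left and
    right of [Y], which no single local unitary produces. *)
Lemma readout_trace a b (f : 'I_2 -> 'M[C]_a) (g : 'I_2 -> 'M[C]_b)
    (P Q P' Q' M N : 'M[C]_2) (Y : 'M[C]_(a * b)) (c c' d d' : 'I_2) :
  P ^t* *m P - Q ^t* *m Q = M -> P' ^t* *m P' - Q' ^t* *m Q' = N ->
  @trace_ancillas R a b 1 1 (tens_map (readout f P Q) (readout g P' Q')
    (swap_middle (Y *t (delta_mx c c' *t delta_mx d d')))) =
  (M c' c * N d' d) *: ((f c *t g d) *m Y *m (f c' *t g d') ^t*).
Proof.
move=> <- <-.
pose x := swap_middle (Y *t (delta_mx c c' *t delta_mx d d')).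
transitivity (trace_ancillas (
  krausmap (readout_op f P *t readout_op g P') x -
  krausmap (readout_op f P *t readout_op g Q') x -
  krausmap (readout_op f Q *t readout_op g P') x +
  krausmap (readout_op f Q *t readout_op g Q') x)).
  by apply: congr1; exact: tens_map_readout.
etransitivity; first exact: trace_ancillas_alternating.
have E S S' := krausmap_readout_trace f g S S' Y c c' d d'.
etransitivity.
  apply: (f_equal4 (fun x y z t => x - y - z + t)).
  - exact: (E P P').
  - exact: (E P Q').
  - exact: (E Q P').
  - exact: (E Q Q').
have mxB (X X' : 'M[C]_2) i j : (X - X') i j = X i j - X' i j by rewrite !mxE.
rewrite !mxB; move: (_ *m Y *m _) => Z {E}.
rewrite -!scalerBl -scalerDl; congr (_ *: _).
by rewrite mulrBl !mulrBr opprB addrA addrAC -addrA addrA addrAC.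
Qed.

End AncillaGates.

(** * Equatorial observables of the ancilla qubits *)

Section FlipPhase.
Variable C : numClosedFieldType.

(** For [e] of modulus one and angle t this is cos t X + sin t Y, the observable of a measurement on
    the equator of the Bloch sphere. *)
Definition flip_phase (e : C) : 'M[C]_2 :=
  \matrix_(i, j) if i == j then 0 else if i == 0 then e^* else e.

Lemma flip_phase_adj e : (flip_phase e) ^t* = flip_phase e.
Proof.
apply/matrixP => -[[|[|//]] ?] -[[|[|//]] ?]; rewrite !mxE /= ?conjC0 ?conjCK //.
Qed.

Lemma flip_phase_sqr e : `|e| = 1 -> flip_phase e *m flip_phase e = 1%:M.
Proof.
move=> e1; have ee : e * e^* = 1 by rewrite -normCK e1 expr1n.
apply/matrixP => -[[|[|//]] ?] -[[|[|//]] ?];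
  rewrite !mxE !big_ord_recl big_ord0 !mxE /= ?(mulr0, mul0r, addr0, add0r) //.
by rewrite mulrC ee.
Qed.

(* Averaging over s cancels the terms in which the two parties are in different
   branches, so only |00><11| and |11><00| survive. *)
Lemma flip_phase_coef (e : C) (c c' d d' : 'I_2) :
  \sum_(s : bool) 4^-1 * (flip_phase (if s then 'i * e else e) c' c *
                          flip_phase (if s then - 'i else 1) d' d) =
  2^-1 * (e * [&& c == 0, d == 0, c' == 1 & d' == 1]%:R +
          e^* * [&& c == 1, d == 1, c' == 0 & d' == 0]%:R).
Proof.
have iM : 'i * 'i = -1 :> C by rewrite -expr2 sqrCi.
have iK (x : C) : 'i * x * 'i = - x by rewrite mulrAC iM mulN1r.
have q2 (x : C) : 4^-1 * x + 4^-1 * x = 2^-1 * x by field.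
have cie : ('i * e)^* = - ('i * e^*) by rewrite rmorphM /= conjCi mulNr.
have cni : (- 'i)^* = 'i :> C by rewrite rmorphN /= conjCi opprK.
rewrite big_bool /= !mxE.
case: c c' d d' => [[|[|//]] ?] [[|[|//]] ?] [[|[|//]] ?] [[|[|//]] ?] /=;
  rewrite ?cie ?cni ?conjC1 ?(mulr0, mul0r, addr0, add0r, mulr1) ?(mulrN, mulNr, opprK);
  rewrite ?iK ?opprK ?mulrN ?opprK ?q2 ?addNr //.
Qed.

(** For a diagonal term all branches carry the same operator and only the sum of the coefficients
    matters. In the second setting the phase is ['i], whose two off-diagonal entries cancel. *)
Lemma flip_phase_coef_sum0 (e e' : C) : e + e^* = 0 ->
  \sum_(p : 'I_2 * 'I_2) \sum_(r : 'I_2 * 'I_2)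
    (4^-1 * (flip_phase e r.1 p.1 * flip_phase e' r.2 p.2)) = 0.
Proof.
move=> e0.
rewrite -(pair_bigA _ (fun p1 p2 => \sum_(r : 'I_2 * 'I_2)
    (4^-1 * (flip_phase e r.1 p1 * flip_phase e' r.2 p2)))) /= exchange_big /=.
rewrite big1// => p2 _; rewrite exchange_big /=.
rewrite -(pair_bigA _ (fun r1 r2 => \sum_(p1 : 'I_2)
    (4^-1 * (flip_phase e r1 p1 * flip_phase e' r2 p2)))) /= exchange_big /=.
rewrite big1// => r2 _; rewrite !big_ord_recl !big_ord0 !mxE /= !mul0r !mulr0.
by rewrite !addr0 !add0r -mulrDr -mulrDl addrC e0 mul0r mulr0.
Qed.

End FlipPhase.

Section LocalDecomposition.
Variable R : realType.
Local Notation C := R[i].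

Lemma sum_flip_phase (V : lmodType C) (Z : 'I_2 * 'I_2 -> 'I_2 * 'I_2 -> V) e :
  \sum_(s : bool) \sum_p \sum_r
    (4^-1 * (flip_phase (if s then Num.imaginary * e else e) r.1 p.1 *
             flip_phase (if s then - Num.imaginary else 1) r.2 p.2)) *: Z p r =
  2^-1 *: (e *: Z (0, 0) (1, 1) + e^* *: Z (1, 1) (0, 0)).
Proof.
rewrite exchange_big /=.
under eq_bigr => p _ do (rewrite exchange_big /=;
  under eq_bigr => r _ do rewrite -scaler_suml flip_phase_coef).
have pick (x : 'I_2 * 'I_2) (y : 'I_2 * 'I_2) : \sum_p \sum_r
    [&& p.1 == x.1, p.2 == x.2, r.1 == y.1 & r.2 == y.2]%:R *: Z p r = Z x y.
  rewrite (bigD1 x)//= addrC big1 ?add0r => [|[p p'] np]; last first.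
    rewrite big1// => r _ /=; move: np; rewrite -pair_eqE negb_and /=.
    by move=> /orP[/negPf->|/negPf->]; rewrite ?andbF scale0r.
  rewrite (bigD1 y)//= addrC big1 ?add0r => [|[r r'] nr]; last first.
    move: nr; rewrite -pair_eqE negb_and /=.
    by move=> /orP[/negPf->|/negPf->]; rewrite ?andbF scale0r.
  by rewrite !eqxx scale1r.
rewrite -[in RHS](pick (0, 0) (1, 1)) -[in RHS](pick (1, 1) (0, 0)).
rewrite scalerDr !scaler_sumr -big_split /=; apply: eq_bigr => p _.
rewrite !scaler_sumr -big_split /=; apply: eq_bigr => r _.
by rewrite !scalerA -scalerDl mulrDr !mulrA.
Qed.

(* Puts the ancilla into a uniform superposition, then applies f c on branch c. *)
Definition branch_gate a (f : 'I_2 -> 'M[C]_a) : 'M[C]_(a * 2) :=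
  controlled f (fun c => delta_mx c c *m hadamard R).

Lemma branch_gate_unitary a (f : 'I_2 -> 'M[C]_a) :
  (forall c, f c \is unitarymx) -> branch_gate f \is unitarymx.
Proof.
move=> uf; rewrite /branch_gate -controlled_mulr; apply: mul_unitarymx.
  rewrite -trmxC_unitary; apply/unitarymxP; rewrite trmxCK.
  exact: controlled_adjl.
apply/unitarymxP; rewrite adjmx_tens tensmx_mul adjmx1 mulmx1.
by rewrite (unitarymxP (hadamard_unitary R)) tensmx1.
Qed.

Lemma branch_state a b (f : 'I_2 -> 'M[C]_a) (g : 'I_2 -> 'M[C]_b) rho :
  krausmap (branch_gate f *t branch_gate g) (@add_ancillas R a b 1 1 rho) =
  \sum_(p : 'I_2 * 'I_2) \sum_(r : 'I_2 * 'I_2)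
    4^-1 *: swap_middle (((f p.1 *t g p.2) *m rho *m (f r.1 *t g r.2) ^t*)
      *t (delta_mx p.1 r.1 *t delta_mx p.2 r.2)).
Proof.
rewrite /add_ancillas.
etransitivity; first exact: krausmap_controlled.
have lin := @swap_middle_linear R a 2 b 2.
rewrite (linear_fun_sum lin); apply: eq_bigr => p _.
rewrite (linear_fun_sum lin); apply: eq_bigr => r _.
rewrite -(linear_funZ lin); congr swap_middle.
(* Each party contributes 1/2 from its own superposition. *)
have q4 : 2^-1 * 2^-1 = 4^-1 :> C by rewrite -invfM -natrM.
rewrite -q4 -tensmxZr -scalerA -tensmxZr -tensmxZl; congr (_ *t (_ *t _)).
  exact: hadamard_outer.
exact: hadamard_outer.
Qed.

End LocalDecomposition.

(** * Assembly of the local protocol *)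

Section UpperBound.
Variable R : realType.
Local Notation C := R[i].

(** The box enters through linearity, acting on the branches one pair at a time; hence the
    coefficients do not depend on it. *)
Lemma branch_readout a b (X : super R (a * b) (a * b)) (f k : 'I_2 -> 'M[C]_a)
    (g h : 'I_2 -> 'M[C]_b) (P Q P' Q' M N : 'M[C]_2) rho :
  linear X ->
  P ^t* *m P - Q ^t* *m Q = M -> P' ^t* *m P' - Q' ^t* *m Q' = N ->
  @trace_ancillas R a b 1 1 (tens_map (readout k P Q) (readout h P' Q')
    (extend_box X (krausmap (branch_gate f *t branch_gate g)
                            (@add_ancillas R a b 1 1 rho)))) =
  \sum_(p : 'I_2 * 'I_2) \sum_(r : 'I_2 * 'I_2)
    (4^-1 * (M r.1 p.1 * N r.2 p.2)) *:
    ((k p.1 *t h p.2) *m X ((f p.1 *t g p.2) *m rho *m (f r.1 *t g r.2) ^t*)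
       *m (k r.1 *t h r.2) ^t*).
Proof.
move=> lX PQ PQ'.
pose T x := @trace_ancillas R a b 1 1 (tens_map (readout k P Q) (readout h P' Q')
    (extend_box X x)).
have lT : linear T.
  have l1 := @extend_box_linear R a b 1 1 X.
  have lr : linear (readout h P' Q').
    by move=> c x y; rewrite /readout !krausmap_linear scalerBr opprD addrACA.
  have l2 := tens_map_linear (readout k P Q) lr.
  exact: (comp_linear (@trace_ancillas_linear R a b 1 1) (comp_linear l2 l1)).
transitivity (T (krausmap (branch_gate f *t branch_gate g) (@add_ancillas R a b 1 1 rho))).
  by [].
etransitivity; first by apply: congr1; exact: branch_state.
rewrite (linear_fun_sum lT); apply: eq_bigr => p _.
rewrite (linear_fun_sum lT); apply: eq_bigr => r _.
rewrite (linear_funZ lT) -scalerA; congr (_ *: _).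
etransitivity.
  apply: (congr1 (fun x => @trace_ancillas R a b 1 1
    (tens_map (readout k P Q) (readout h P' Q') x))).
  exact: extend_box_swap_middle.
exact: readout_trace.
Qed.

Definition pick2 (K : Type) (k l : K) (c : 'I_2) : K := if c == 0 then k else l.

Lemma normc_ge0 (z : C) : 0 <= normc z.
Proof. by case: z => x y; exact: sqrtr_ge0. Qed.

(** On the diagonal the second setting contributes zero, so its coefficient may be set to 0. This is
    why a diagonal term is charged once and any other pair twice. *)
Lemma sum_flip_block (V : lmodType C) (Z : 'I_2 * 'I_2 -> 'I_2 * 'I_2 -> V)
    (n e : C) (diag : bool) :
  (diag -> e = 1) -> (diag -> forall p r, Z p r = Z (0, 0) (1, 1)) ->
  \sum_(s : bool) (n * (~~ diag || ~~ s)%:R) *: (\sum_p \sum_r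
    (4^-1 * (flip_phase (if s then Num.imaginary * e else e) r.1 p.1 *
             flip_phase (if s then - Num.imaginary else 1) r.2 p.2)) *: Z p r) =
  2^-1 *: ((n * e) *: Z (0, 0) (1, 1) + (n * e^*) *: Z (1, 1) (0, 0)).
Proof.
move=> e1 Z1.
transitivity (n *: (2^-1 *: (e *: Z (0, 0) (1, 1) + e^* *: Z (1, 1) (0, 0)))); last first.
  by rewrite scalerA mulrC -[LHS]scalerA scalerDr !scalerA.
rewrite -sum_flip_phase.
case: diag e1 Z1 => [/(_ isT) -> /(_ isT) Z1|_ _].
  rewrite !big_bool /= mulr0 scale0r add0r mulr1 scalerDr.
  rewrite [X in _ = n *: X + _](_ : _ = 0) ?scaler0 ?add0r//.
  transitivity (\sum_(p : 'I_2 * 'I_2) \sum_(r : 'I_2 * 'I_2)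
    (4^-1 * (flip_phase (Num.imaginary * 1) r.1 p.1 *
      flip_phase (- Num.imaginary) r.2 p.2)) *: Z (0, 0) (1, 1)).
    by apply: eq_bigr => p _; apply: eq_bigr => r _; rewrite Z1.
  under eq_bigr do rewrite -scaler_suml.
  rewrite -scaler_suml flip_phase_coef_sum0 ?scale0r//.
  by rewrite mulr1 conjCi subrr.
by rewrite scaler_sumr; apply: eq_bigr => s _; rewrite mulr1.
Qed.

(** The protocol for an ordered pair yields half the sum of its own term and the transposed one;
    over all ordered pairs each term is met twice. *)
Lemma sum_hermitian_pairs (V : lmodType C) (K : finType) (c : K -> K -> C)
    (Z : K -> K -> V) :
  \sum_x \sum_y 2^-1 *: (c x y *: Z x y + c y x *: Z y x) = \sum_x \sum_y c x y *: Z x y.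
Proof.
rewrite -[RHS]half_double [X in _ *: (_ + X)]exchange_big /= -big_split scaler_sumr.
apply: eq_bigr => x _; rewrite -big_split scaler_sumr.
by apply: eq_bigr.
Qed.

(** [f] and [g] act before the box, [k] and [h] after it. All ordered pairs, diagonal ones included,
    run through the same protocol; an index in [J] is a pair with a setting, and the number of
    settings used gives the factor [1 + (x != y)]. *)
Lemma LO_decomposition a b (K : finType) (f k : K -> 'M[C]_a) (g h : K -> 'M[C]_b)
    (w : K -> C) (E1 E2 : super R (a * b) (a * b)) :
  (0 < #|K|)%N ->
  (forall x, f x \is unitarymx) -> (forall x, k x \is unitarymx) ->
  (forall x, g x \is unitarymx) -> (forall x, h x \is unitarymx) ->
  (forall X rho, linear X -> E1 (X (E2 rho)) =
    \sum_x \sum_y (w x * (w y)^*) *: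
      ((k x *t h x) *m X ((f x *t g x) *m rho *m (f y *t g y) ^t*) *m (k y *t h y) ^t*)) ->
  blackbox_costs (@LO R) E1 E2
    (\sum_x \sum_y (1 + (x != y)%:R) * (normc (w x) * normc (w y))).
Proof.
move=> K0 uf uk ug uh EX.
(* On the diagonal the phase is set to 1 even where [w] vanishes, since the cancellation of the
   second setting depends on it. *)
have ph_ex (xy : K * K) : exists e : C,
    [/\ `|e| = 1, w xy.1 * (w xy.2)^* = `|w xy.1| * `|w xy.2| * e
    & xy.1 = xy.2 -> e = 1].
  case: xy => x y /=; have [->|nxy] := eqVneq x y.
    by exists 1; rewrite normr1 mulr1 -normCK expr2.
  have [e [e1 wE]] := polar_phase (w x * (w y)^*).
  by exists e; split=> // [|xy]; [rewrite wE normrM norm_conjC|rewrite xy eqxx in nxy].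
have [ph phP] := fin_all_exists ph_ex.
pose J := (K * K * bool)%type.
pose A (j : J) := flip_phase (if j.2 then Num.imaginary * ph j.1 else ph j.1).
pose B (j : J) : 'M[C]_2 := flip_phase (if j.2 then - Num.imaginary else 1).
pose s (j : J) := @pick2 K j.1.1 j.1.2.
pose FA (j : J) := readout (k \o s j) (half_proj (A j) false) (half_proj (A j) true).
pose FB (j : J) := readout (h \o s j) (half_proj (B j) false) (half_proj (B j) true).
pose F (j : J) : super R _ _ := tens_map (FA j) (FB j).
pose G (j : J) := krausmap (branch_gate (f \o s j) *t branch_gate (g \o s j)).
pose q (j : J) : R := normc (w j.1.1) * normc (w j.1.2) *
  ((j.1.1 != j.1.2) || ~~ j.2)%:R.
have AA j : A j *m A j = 1%:M.
  apply: flip_phase_sqr; have [e1 _ _] := phP j.1.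
  by case: (j.2); rewrite ?normrM ?normCi ?mul1r.
have BB j : B j *m B j = 1%:M.
  apply: flip_phase_sqr.
  by case: (j.2); rewrite ?normrN ?normCi ?normr1.
have proj_sum (M : 'M[C]_2) : M ^t* = M -> M *m M = 1%:M ->
    (half_proj M false) ^t* *m half_proj M false +
    (half_proj M true) ^t* *m half_proj M true = 1%:M.
  move=> Mh MM; rewrite -(half_projD M).
  by congr (_ + _); exact: half_proj_sqr.
have proj_diff (M : 'M[C]_2) : M ^t* = M -> M *m M = 1%:M ->
    (half_proj M false) ^t* *m half_proj M false -
    (half_proj M true) ^t* *m half_proj M true = M.
  move=> Mh MM; rewrite -[RHS](half_projB M).
  by congr (_ - _); exact: half_proj_sqr.
(* The witnesses are dimensions minus one: each ancilla is a qubit. *)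
exists 1%N, 1%N, #|{: J}|, (fun i => q (enum_val i)),
  (fun i => F (enum_val i)), (fun i => G (enum_val i)).
split.
- by rewrite !card_prod card_bool !muln_gt0 K0.
- move=> i; split.
    exists (FA (enum_val i)), (FB (enum_val i)).
    split=> //; apply: readout_calN => [c|]; rewrite /= ?uk ?uh//; apply: proj_sum => //;
      exact: flip_phase_adj.
  by apply: unitary_LO; apply: branch_gate_unitary => c; rewrite /= ?uf ?ug.
- move=> X [[lX _] _] rho; rewrite EX//.
  rewrite (linear_fun_sum (@trace_ancillas_linear R a b 1 1)).
  pose W j := \sum_(p : 'I_2 * 'I_2) \sum_(r : 'I_2 * 'I_2)
    (4^-1 * (A j r.1 p.1 * B j r.2 p.2)) *:
    ((k (s j p.1) *t h (s j p.2)) *m X ((f (s j p.1) *t g (s j p.2)) *m rho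
       *m (f (s j r.1) *t g (s j r.2)) ^t*) *m (k (s j r.1) *t h (s j r.2)) ^t*).
  transitivity (\sum_(j : J) (q j)%:C%C *: W j).
    transitivity (\sum_xy \sum_t (q (xy, t))%:C%C *: W (xy, t)); last first.
      by rewrite pair_bigA; apply: eq_bigr => -[].
    rewrite -sum_hermitian_pairs pair_bigA; apply: eq_bigr => -[x y] _ /=.
    have [e1 wE diag] := phP (x, y); rewrite /= in wE diag.
    have qE t : (q (x, y, t))%:C%C = `|w x| * `|w y| * (~~ (x == y) || ~~ t)%:R.
      by rewrite /q !rmorphM /= rmorph_nat.
    have wE' : w y * (w x)^* = `|w x| * `|w y| * (ph (x, y))^*.
      rewrite -[LHS]conjCK rmorphM /= conjCK mulrC wE !rmorphM /=.
      by rewrite !(CrealP (normr_real _)).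
    under [RHS]eq_bigr do rewrite qE.
    rewrite wE wE'; symmetry.
    pose ZZ (p r : 'I_2 * 'I_2) := (k (pick2 x y p.1) *t h (pick2 x y p.2)) *m
      X ((f (pick2 x y p.1) *t g (pick2 x y p.2)) *m rho
         *m (f (pick2 x y r.1) *t g (pick2 x y r.2)) ^t*)
      *m (k (pick2 x y r.1) *t h (pick2 x y r.2)) ^t*.
    have d1 : x == y -> ph (x, y) = 1 by move/eqP/diag.
    have d2 : x == y -> forall p r, ZZ p r = ZZ (0, 0) (1, 1).
      by move=> /eqP xy p r; rewrite /ZZ /pick2 xy !if_same.
    have H := sum_flip_block (`|w x| * `|w y|) d1 d2.
    by etransitivity; [|exact: H].
  rewrite (reindex (@enum_val J xpredT)) /=; last first.
    exact: (onW_bij _ (@enum_val_bij J)).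
  apply: eq_bigr => i _; rewrite (linear_funZ (@trace_ancillas_linear R a b 1 1)).
  congr (_ *: _); symmetry; apply: branch_readout => //; apply: proj_diff => //;
    exact: flip_phase_adj.
- rewrite (reindex (@enum_rank J)) /=; last exact: (onW_bij _ (@enum_rank_bij J)).
  rewrite pair_bigA.
  rewrite [RHS](eq_bigr (fun j : J => `|q (j.1, j.2)|)); last first.
    by move=> [xy t] _; rewrite enum_rankK.
  rewrite -(pair_bigA _ (fun xy t => `|q (xy, t)|)) /=.
  apply: eq_bigr => -[x y] _ /=; rewrite big_bool /q /=.
  rewrite !ger0_norm ?mulr_ge0 ?normc_ge0 ?ler0n// orbF orbT.
  by rewrite -mulrDr mulrC addrC.
Qed.

End UpperBound.

(** * Optimality *)

Section Comparison.
Variable R : realType.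
Local Notation C := R[i].

Lemma tens_map_comp_id a b a' b' (f : super R a a') (g : super R b b') rho :
  linear f -> linear g ->
  tens_map (@id 'M[C]_a') g (tens_map f (@id 'M[C]_b) rho) = tens_map f g rho.
Proof.
move=> lf lg; move: rho.
apply: (@eq_linear_tens _ _ _ _ (tens_map (@id 'M[C]_a') g \o tens_map f (@id 'M[C]_b))).
- by apply: comp_linear; exact: tens_map_linear.
- exact: tens_map_linear.
by move=> s t; rewrite /= !tens_map_tens.
Qed.

Lemma sum_two_rounds (V : nmodType) (F : {_ : {_ : unit & bool} & bool} -> V) :
  \sum_p F p =
  \sum_s \sum_t F (existT (fun=> bool) (existT (fun=> bool) tt s) t).
Proof.
rewrite pair_bigA (reindex (fun st : bool * bool =>
  existT (fun=> bool) (existT (fun=> bool) tt st.1) st.2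
  : {_ : {_ : unit & bool} & bool})) //.
exists (fun p => (tagged (tag p), tagged p)) => [[s t] _|[[[] s] t] _] //.
Qed.

(** Two rounds suffice: A applies the instrument formed by [Ap] and [Am], then B the one formed by
    [Bp] and [Bm]. The sign of an outcome is the parity of the two results. *)
Lemma LO_LOCC a b (F : super R (a * b) (a * b)) : LO F -> LOCC F.
Proof.
move=> [FA [FB [[Ap [Am [cAp cAm cA AE]]] [Bp [Bm [cBp cBm cB BE]]] FE]]].
pose A (s : bool) := if s then Am else Ap.
pose B (s : bool) := if s then Bm else Bp.
have CPA s : CP (A s) by case: s; [exact: cAm|exact: cAp].
have CPB s : CP (B s) by case: s; [exact: cBm|exact: cBp].
have instrA : instrument A.
  split; first by [].
  by move=> rho; rewrite big_bool /= addrC; apply: cA.2.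
have instrB : instrument B.
  split; first by [].
  by move=> rho; rewrite big_bool /= addrC; apply: cB.2.
pose GA (_ : unit) (s : bool) : super R (a * b) (a * b) := tens_map (A s) (@id 'M[C]_b).
pose GB (_ : {_ : unit & bool}) (s : bool) : super R (a * b) (a * b) :=
  tens_map (@id 'M[C]_a) (B s).
have rA : forall i, one_way_fromA (GA i) \/ one_way_fromB (GA i).
  move=> i; left; exists A, (fun=> @id 'M[C]_b).
  by split; [exact: instrA|move=> _; exact: id_CPTP|].
have rB : forall i, one_way_fromA (GB i) \/ one_way_fromB (GB i).
  move=> i; right; exists (fun=> @id 'M[C]_a), B.
  by split; [move=> _; exact: id_CPTP|exact: instrB|].
have rounds := LoccRound (LoccRound (@LoccStart R a b) rA) rB.
exists {_ : {_ : unit & bool} & bool}, (fun p => GB (tag p) (tagged p) \o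
   (GA (tag (tag p)) (tagged (tag p)) \o id)), (fun p => tagged p (+) tagged (tag p)).
split.
  exists {_ : {_ : unit & bool} & bool}, (fun p => GB (tag p) (tagged p) \o
   (GA (tag (tag p)) (tagged (tag p)) \o id)), id; split; first exact: rounds.
  by move=> k rho; rewrite big_pred1_eq.
move=> rho.
rewrite sum_two_rounds.
transitivity (\sum_(s : bool) \sum_(t : bool)
    (-1) ^+ (t (+) s) *: tens_map (A s) (B t) rho); last first.
  apply: eq_bigr => s _; apply: eq_bigr => t _; congr (_ *: _); symmetry.
  exact: (tens_map_comp_id rho (CPA s).1 (CPB t).1).
rewrite FE; transitivity (tens_map (fun x => Ap x - Am x) (fun x => Bp x - Bm x) rho).
  by apply: eq_bigr => i _; apply: eq_bigr => j _; rewrite AE BE.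
rewrite tens_mapBB !big_bool /=.
move: (tens_map Ap Bp rho) (tens_map Ap Bm rho) (tens_map Am Bp rho) (tens_map Am Bm rho).
move=> x y z t; rewrite !expr0 !expr1 !scale1r !scaleN1r.
by rewrite [RHS]addrC [t - z]addrC addrA [- y + x]addrC.
Qed.

(** The outer local unitaries are absorbed into the Pauli matrices, which stay unitary and mutually
    orthogonal. The upper bound uses unitarity, the lower bound both properties. *)
Lemma KAK_gate (U : 'M[C]_(2 * 2)) (u : 'I_4 -> C) : is_KAK U u ->
  exists S T : 'I_4 -> 'M[C]_2,
    [/\ forall k, S k \is unitarymx, forall k, T k \is unitarymx,
        forall k l, k != l -> \tr ((S k) ^t* *m S l) = 0,
        forall k l, k != l -> \tr ((T k) ^t* *m T l) = 0
      & forall nA nB (i : 'I_nA) (j : 'I_nB),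
          gate_on i j U = \sum_k u k *: (one_qubit i (S k) *t one_qubit j (T k))].
Proof.
case=> _ [V1 [V2 [V3 [V4 [u1 u2 u3 u4 UE]]]]].
have pauliU k : pauli R k \is unitarymx.
  by apply/unitarymxP; rewrite pauli_adj pauli_mul.
have frame (W W' : 'M[C]_2) : W \is unitarymx -> W' \is unitarymx ->
    (forall k, W *m pauli R k *m W' \is unitarymx) /\
    (forall k l, k != l -> \tr ((W *m pauli R k *m W') ^t* *m (W *m pauli R l *m W')) = 0).
  move=> uW uW'; split=> [k|k l kl].
    by apply: mul_unitarymx uW'; exact: mul_unitarymx uW (pauliU k).
  rewrite !adjmx_mul pauli_adj mxtrace_mulC -!mulmxA (mulmxA W') (unitarymxP uW') mul1mx.
  rewrite mxtrace_mulC -!mulmxA (unitarymx_adjl uW) mulmx1.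
  by rewrite mxtrace_pauli_mul// eq_sym.
have [SU SO] := frame V1 V3 u1 u3; have [TU TO] := frame V2 V4 u2 u4.
exists (fun k => V1 *m pauli R k *m V3), (fun k => V2 *m pauli R k *m V4); split;
  [exact: SU|exact: TU|exact: SO|exact: TO|move=> nA nB i j].
have -> : U = \sum_k u k *: ((V1 *m pauli R k *m V3) *t (V2 *m pauli R k *m V4)).
  rewrite UE mulmx_sumr mulmx_suml; apply: eq_bigr => k _.
  by rewrite -scalemxAr -scalemxAl !tensmx_mul.
by rewrite gate_on_sum; apply: eq_bigr => k _; rewrite gate_on_tens.
Qed.

Lemma tens_unitary m n (P : 'M[C]_m) (Q : 'M[C]_n) :
  P \is unitarymx -> Q \is unitarymx -> P *t Q \is unitarymx.
Proof.
move=> /unitarymxP uP /unitarymxP uQ; apply/unitarymxP.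
by rewrite adjmx_tens tensmx_mul uP uQ tensmx1.
Qed.

Lemma add_ancillas_separable a b eA eB :
  signed_separable (@add_ancillas R a b eA eB).
Proof.
apply: (@product_kraus_signed_separable R a b (a * eA.+1) (b * eB.+1) _
  [:: (ancilla_ket R a (ord0 : 'I_eA.+1), ancilla_ket R b (ord0 : 'I_eB.+1))]).
  by move=> rho; rewrite add_ancillas_kraus /product_kraus big_seq1.
exact: mxtrace_add_ancillas.
Qed.

Lemma trace_ancillas_separable a b eA eB :
  signed_separable (@trace_ancillas R a b eA eB).
Proof.
apply: (@product_kraus_signed_separable R (a * eA.+1) (b * eB.+1) a b _
  [seq ((ancilla_ket R a k.1) ^t*, (ancilla_ket R b k.2) ^t*) |
    k <- enum {: 'I_eA.+1 * 'I_eB.+1}]).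
  by move=> rho; rewrite trace_ancillas_kraus /product_kraus big_map big_enum.
exact: mxtrace_trace_ancillas.
Qed.

Lemma extend_box_separable a b eA eB (P : 'M[C]_a) (Q : 'M[C]_b) :
  P \is unitarymx -> Q \is unitarymx ->
  signed_separable (@extend_box R a b eA eB (unitary_channel (P *t Q))).
Proof.
move=> uP uQ.
have u1 n : (1%:M : 'M[C]_n) \is unitarymx by apply/unitarymxP; rewrite adjmx1 mulmx1.
have uE := tens_unitary (tens_unitary uP (u1 eA.+1)) (tens_unitary uQ (u1 eB.+1)).
apply: (@product_kraus_signed_separable R (a * eA.+1) (b * eB.+1) (a * eA.+1) (b * eB.+1) _
  [:: (P *t 1%:M, Q *t 1%:M)]).
  by move=> rho; rewrite extend_box_kraus /product_kraus big_seq1.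
by move=> rho; rewrite extend_box_kraus (unitary_channel_CPTP uE).2.
Qed.

(** Distinct indices differ in one component, where a factor of the trace vanishes whatever [c] is;
    for equal indices unitarity of [W k] gives the norm without evaluating [c]. *)
Lemma two_gates_orthogonal n (i j : 'I_n) (P : 'M[C]_(2 ^ n)) (c : C)
    (S S' : 'I_4 -> 'M[C]_2) :
  P \is unitarymx -> (forall k, S k \is unitarymx) -> (forall k, S' k \is unitarymx) ->
  (forall k l, k != l -> \tr ((S k) ^t* *m S l) = 0) ->
  (forall k l, k != l -> \tr ((S' k) ^t* *m S' l) = 0) ->
  (forall X X' Y Y' : 'M[C]_2,
    \tr ((one_qubit i X *m P *m one_qubit j X') ^t*
         *m (one_qubit i Y *m P *m one_qubit j Y')) =
    \tr (X ^t* *m Y) * \tr (X' ^t* *m Y') * c) ->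
  let W (k : 'I_4 * 'I_4) := one_qubit i (S k.1) *m P *m one_qubit j (S' k.2) in
  forall k l, \tr ((W k) ^t* *m W l) = (2 ^ n)%:R * (k == l)%:R.
Proof.
move=> uP uS uS' oS oS' par W k l.
have [<-|nkl] := eqVneq k l.
  have uW : W k \is unitarymx.
    apply: mul_unitarymx; last exact: one_qubit_unitary (uS' _).
    exact: mul_unitarymx (one_qubit_unitary i (uS _)) uP.
  by rewrite (unitarymx_adjl uW) mxtrace1 mulr1.
rewrite par mulr0; move: nkl; rewrite -pair_eqE negb_and => /orP[/oS|/oS'] ->.
  by rewrite !mul0r.
by rewrite mulr0 mul0r.
Qed.

Lemma blackbox_lower_bound nA nB (A1 A2 : 'I_nA) (B1 B2 : 'I_nB)
    (U V : 'M[C]_(2 * 2)) (u v : 'I_4 -> C) (c : R) :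
  (1 < nA)%N -> (1 < nB)%N -> is_KAK U u -> is_KAK V v ->
  blackbox_costs (@LOCC R) (unitary_channel (gate_on A1 B1 U))
    (unitary_channel (gate_on A2 B2 V)) c ->
  2 * (\sum_(k : 'I_4 * 'I_4) `|u k.1 * v k.2|) ^+ 2 - 1 <= c%:C%C.
Proof.
move=> nA1 nB1 kU kV [eA [eB [m [q [F [G [_ FG EX ->]]]]]]].
have [S [T [uS uT oS oT UE]]] := KAK_gate kU.
have [S' [T' [uS' uT' oS' oT' VE]]] := KAK_gate kV.
have [P [cA [uP parA]]] := one_qubit_parallel R A1 A2 nA1.
have [Q [cB [uQ parB]]] := one_qubit_parallel R B1 B2 nB1.
pose WA (k : 'I_4 * 'I_4) := one_qubit A1 (S k.1) *m P *m one_qubit A2 (S' k.2).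
pose WB (k : 'I_4 * 'I_4) := one_qubit B1 (T k.1) *m Q *m one_qubit B2 (T' k.2).
pose X := unitary_channel (P *t Q).
(* A composite of five signed separable maps; the box is one of them because [P *t Q] is local. *)
pose N (i : 'I_m) rho := trace_ancillas (F i (extend_box X (G i (add_ancillas eA eB rho)))).
have cost_sum : (\sum_i `|q i|)%:C%C = \sum_i `|(q i)%:C%C| :> C.
  rewrite rmorph_sum; apply: eq_bigr => i _ /=.
  by rewrite normc_def /= expr0n addr0 sqrtr_sqr.
rewrite cost_sum.
apply: (@signed_separable_cost R _ _ _ WA WB (fun k => u k.1 * v k.2) _ q N).
- by rewrite expn_gt0.
- by rewrite expn_gt0.
- exact: two_gates_orthogonal uP uS uS' oS oS' parA.
- exact: two_gates_orthogonal uQ uT uT' oT oT' parB.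
- case: kU kV => u1 _ [v1 _].
  rewrite -(pair_bigA _ (fun k l => `|u k * v l| ^+ 2)) /=.
  have n1 (x : 'I_4 -> C) : \sum_k normc (x k) ^+ 2 = 1 -> \sum_k `|x k| ^+ 2 = 1.
    by move=> /(congr1 (fun r => r%:C%C)); rewrite rmorph_sum rmorph1 => <-;
       apply: eq_bigr => k _; rewrite rmorphXn.
  under eq_bigr do under eq_bigr do rewrite normrM exprMn.
  under eq_bigr do rewrite -mulr_sumr (n1 v v1) mulr1.
  exact: n1.
- move=> i; have [sF sG] := FG i.
  have := signed_separable_comp (signed_separable_comp (signed_separable_comp
    (signed_separable_comp (add_ancillas_separable _ _ eA eB) (LOCC_signed_separable sG))
      (extend_box_separable eA eB uP uQ)) (LOCC_signed_separable sF))
      (trace_ancillas_separable _ _ eA eB).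
  exact.
- move=> rho.
  have lt := @trace_ancillas_linear R (2 ^ nA) (2 ^ nB) eA eB.
  transitivity (unitary_channel (gate_on A1 B1 U)
    (X (unitary_channel (gate_on A2 B2 V) rho))).
    rewrite [RHS]krausmap_comp krausmap_comp; congr krausmap.
    transitivity (\sum_k \sum_l (u k * v l) *: (WA (k, l) *t WB (k, l))).
      by rewrite pair_bigA; apply: eq_bigr => -[].
    rewrite UE VE mulmx_suml mulmx_suml; apply: eq_bigr => k _.
    rewrite mulmx_sumr; apply: eq_bigr => l _.
    by rewrite -!scalemxAl -scalemxAr scalerA !tensmx_mul.
  rewrite (EX X (unitary_channel_CPTP (tens_unitary uP uQ)) rho).
  rewrite (linear_fun_sum lt); apply: eq_bigr => i _.
  exact: (linear_funZ lt).
Qed.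

End Comparison.

(** * Agreement of the two bounds *)

Section Optimum.
Variable R : realType.
Local Notation C := R[i].

(** Normalisation turns the diagonal part of the squared sum into 1. The first equation evaluates
    the cost of the construction, the second the lower bound. *)
Lemma sum_off_diagonal (K : finType) (n : K -> R) : \sum_k n k ^+ 2 = 1 ->
  \sum_x \sum_y (1 + (x != y)%:R) * (n x * n y) =
  1 + 2 * \sum_x \sum_(y | x != y) n x * n y /\
  2 * (\sum_k n k) ^+ 2 - 1 = 1 + 2 * \sum_x \sum_(y | x != y) n x * n y.
Proof.
move=> n1.
have off : \sum_x \sum_(y | x != y) n x * n y = (\sum_k n k) ^+ 2 - 1.
  rewrite -n1 expr2 mulr_suml -sumrB; apply: eq_bigr => x _.
  rewrite mulr_sumr [X in _ = X - _](bigD1 x)//= expr2 [RHS]addrAC subrr add0r.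
  by apply: eq_bigl => y; rewrite eq_sym.
have all : \sum_x \sum_y (1 + (x != y)%:R) * (n x * n y) =
    (\sum_k n k) ^+ 2 + \sum_x \sum_(y | x != y) n x * n y.
  rewrite expr2 mulr_suml -big_split; apply: eq_bigr => x _ /=.
  rewrite mulr_sumr [X in _ = _ + X]big_mkcond -big_split; apply: eq_bigr => y _ /=.
  by rewrite mulrDl mul1r; case: eqP => _; rewrite ?mul0r ?mul1r.
by rewrite all off; split; ring.
Qed.

Lemma inf_minimum (S : set R) (c : R) :
  S c -> (forall x, S x -> c <= x) -> inf S = c.
Proof.
move=> Sc Sge; apply/le_anti/andP; split.
  by apply: ge_inf => //; exists c.
by apply: lb_le_inf => //; exists c.
Qed.

Lemma krausmap_comb m n (K : finType) (c : K -> C) (M : K -> 'M[C]_(n, m))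
    (A : 'M[C]_(n, m)) rho :
  A = \sum_k c k *: M k ->
  krausmap A rho = \sum_k \sum_l (c k * (c l)^*) *: (M k *m rho *m (M l) ^t*).
Proof.
move=> ->; rewrite /krausmap adjmx_sum mulmx_suml mulmx_suml; apply: eq_bigr => k _.
rewrite mulmx_sumr; apply: eq_bigr => l _.
by rewrite adjmxZ -!scalemxAl -scalemxAr scalerA.
Qed.

(** [x] collects the indices of both gates on the left of the state and [y] those on its right, so
    the products [w x] appear as coefficients even though the box separates the gates. *)
Lemma krausmap_box_comb a b (K L : finType) (u : K -> C) (v : L -> C)
    (M : K -> 'M[C]_a) (N : L -> 'M[C]_b) (A : 'M[C]_a) (B : 'M[C]_b)
    (X : super R b a) rho :
  linear X -> A = \sum_k u k *: M k -> B = \sum_l v l *: N l ->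
  krausmap A (X (krausmap B rho)) =
  \sum_(x : K * L) \sum_(y : K * L) ((u x.1 * v x.2) * (u y.1 * v y.2)^*) *:
    (M x.1 *m X (N x.2 *m rho *m (N y.2) ^t*) *m (M y.1) ^t*).
Proof.
move=> lX AE BE; rewrite (krausmap_comb _ AE) (krausmap_comb _ BE).
transitivity (\sum_k \sum_k' \sum_l \sum_l' ((u k * v k') * (u l * v l')^*) *:
    (M k *m X (N k' *m rho *m (N l') ^t*) *m (M l) ^t*)); last first.
  rewrite pair_bigA; apply: eq_bigr => -[k k'] _ /=.
  by rewrite pair_bigA.
apply: eq_bigr => k _; rewrite [RHS]exchange_big /=; apply: eq_bigr => l _.
rewrite (linear_fun_sum lX) mulmx_sumr mulmx_suml scaler_sumr; apply: eq_bigr => k' _.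
rewrite (linear_fun_sum lX) mulmx_sumr mulmx_suml scaler_sumr; apply: eq_bigr => l' _.
rewrite (linear_funZ lX) -scalemxAr -scalemxAl scalerA; congr (_ *: _).
by rewrite rmorphM mulrACA.
Qed.

End Optimum.

Theorem theorem6p2 (R : realType) (nA nB : nat)
    (nA_gt1 : (1 < nA)%N) (nB_gt1 : (1 < nB)%N)
    (A1 A2 : 'I_nA) (B1 B2 : 'I_nB)
    (U V : 'M[R[i]]_(2 * 2)) (u v : 'I_4 -> R[i]) :
  U \is unitarymx -> V \is unitarymx -> is_KAK U u -> is_KAK V v ->
  let w (k : 'I_4 * 'I_4) : R[i] := u k.1 * v k.2 in
  let EU := unitary_channel (gate_on A1 B1 U) in
  let EV := unitary_channel (gate_on A2 B2 V) in
  [/\ has_optimal_decomposition (@LOCC R) EU EV,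
      has_optimal_decomposition (@LO R) EU EV,
      blackbox_gamma (@LOCC R) EU EV = blackbox_gamma (@LO R) EU EV
    & blackbox_gamma (@LO R) EU EV =
      1 + 2 * \sum_(k : 'I_4 * 'I_4) \sum_(k' : 'I_4 * 'I_4 | k != k')
                normc (w k) * normc (w k')].
Proof.
move=> _ _ kU kV w EU EV.
pose c := 1 + 2 * \sum_(k : 'I_4 * 'I_4) \sum_(k' : 'I_4 * 'I_4 | k != k')
                normc (w k) * normc (w k').
have w1 : \sum_k normc (w k) ^+ 2 = 1.
  case: kU kV => u1 _ [v1 _].
  rewrite -(pair_bigA _ (fun k l => normc (u k * v l) ^+ 2)) /=.
  under eq_bigr do under eq_bigr do rewrite ComplexField.Normc.normcM exprMn.
  by under eq_bigr do rewrite -mulr_sumr v1 mulr1.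
have [upE loE] := sum_off_diagonal w1.
have LOc : blackbox_costs (@LO R) EU EV c.
  have [S [T [uS uT oS oT UE]]] := KAK_gate kU.
  have [S' [T' [uS' uT' oS' oT' VE]]] := KAK_gate kV.
  rewrite /c -upE.
  apply: (@LO_decomposition R _ _ _ (fun k => one_qubit A2 (S' k.2))
    (fun k => one_qubit A1 (S k.1)) (fun k => one_qubit B2 (T' k.2))
    (fun k => one_qubit B1 (T k.1)) w).
  - by rewrite card_prod card_ord.
  - by move=> k; exact: one_qubit_unitary.
  - by move=> k; exact: one_qubit_unitary.
  - by move=> k; exact: one_qubit_unitary.
  - by move=> k; exact: one_qubit_unitary.
  move=> X rho lX.
  exact: (krausmap_box_comb rho lX (UE _ _ A1 B1) (VE _ _ A2 B2)).
(* By inclusion of LO in LOCC, one construction attains the value for both classes and one lower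
   bound serves both. *)
have LOCCc : blackbox_costs (@LOCC R) EU EV c.
  have [eA [eB [m [q [F [G [m0 FG EX cE]]]]]]] := LOc.
  exists eA, eB, m, q, F, G; split=> //.
  by move=> i; have [F1 G1] := FG i; split; exact: LO_LOCC.
have lower x : blackbox_costs (@LOCC R) EU EV x -> c <= x.
  move=> /(blackbox_lower_bound nA_gt1 nB_gt1 kU kV).
  rewrite /c -loE -lecR !rmorphB rmorphM rmorphXn rmorph_sum rmorph1 /= rmorph_nat.
  exact.
have lowerLO x : blackbox_costs (@LO R) EU EV x -> c <= x.
  move=> [eA [eB [m [q [F [G [m0 FG EX cE]]]]]]]; apply: lower.
  exists eA, eB, m, q, F, G; split=> //.
  by move=> i; have [F1 G1] := FG i; split; exact: LO_LOCC.
have gLOCC := inf_minimum LOCCc lower; have gLO := inf_minimum LOc lowerLO.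
rewrite /has_optimal_decomposition /blackbox_gamma gLOCC gLO.
by split.
Qed.
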